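(* Let $\beta\in(0,1)$, $\alpha>0$, $\varepsilon>0$, $\rho\ge 0$, $\kappa\in[0,1)$, and consider the system $$x'=y,\qquad y'=\rho z^2\cos x+(z^2+\kappa)\sin x\cos x-\sin x-\varepsilon y,\qquad z'=\alpha(\cos x-\beta)$$ on $(0,\pi/2)\times\mathbb R\times[0,\infty)$, with equilibrium point $$P_0=\Big(\arccos\beta,\;0,\;\frac{(1-\kappa\beta)^{1/2}(1-\beta^2)^{1/4}}{\beta^{1/2}\big(\rho+(1-\beta^2)^{1/2}\big)^{1/2}}\Big).$$ Define $$\varepsilon_c=\frac{2\alpha\beta^{3/2}(1-\beta^2)^{3/4}(1-\kappa\beta)^{1/2}\big(\rho+(1-\beta^2)^{1/2}\big)^{3/2}}{(1-\beta^2)^{3/2}+\rho(1-\kappa\beta^3)}.$$ If $\varepsilon>\varepsilon_c$, then $P_0$ is an asymptotically stable equilibrium point. If $0<\varepsilon<\varepsilon_c$, then $P_0$ is unstable.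
   Context: This system is the nondimensionalized model of a steam engine coupled with a hexagonal centrifugal governor with a spring. Here $x$ is the angle of the governor arms, $y$ is a rescaled angular velocity of the arms, and $z$ is a rescaled engine speed. The parameter $\varepsilon$ is a rescaled friction coefficient, $\rho$ is a ratio of lengths, and $\kappa$ is a rescaled spring constant. The point $P_0$ is the unique equilibrium of the system in the domain $(0,\pi/2)\times\mathbb R\times[0,\infty)$. *)

(* Defs.v *)
From Stdlib Require Import Reals.
From Coquelicot Require Import Coquelicot.
Open Scope R_scope.

Definition gov_f1 (x y z : R) : R := y.
Definition gov_f2 (eps rho kappa : R) (x y z : R) : R :=
  rho * z ^ 2 * cos x + (z ^ 2 + kappa) * sin x * cos x - sin x - eps * y.
Definition gov_f3 (alpha beta : R) (x y z : R) : R := alpha * (cos x - beta).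

Definition gov_sol_on (alpha beta eps rho kappa : R) (D : R -> Prop)
    (x y z : R -> R) : Prop :=
  forall t, D t ->
    is_derive x t (gov_f1 (x t) (y t) (z t)) /\
    is_derive y t (gov_f2 eps rho kappa (x t) (y t) (z t)) /\
    is_derive z t (gov_f3 alpha beta (x t) (y t) (z t)).

Definition dist3 (a1 a2 a3 b1 b2 b3 : R) : R :=
  sqrt ((a1 - b1) ^ 2 + (a2 - b2) ^ 2 + (a3 - b3) ^ 2).

Definition gov_stable (alpha beta eps rho kappa : R) (p1 p2 p3 : R) : Prop :=
  forall e, 0 < e -> exists d, 0 < d /\
    forall (T : R) (x y z : R -> R),
      gov_sol_on alpha beta eps rho kappa (fun t => 0 <= t <= T) x y z ->
      dist3 (x 0) (y 0) (z 0) p1 p2 p3 < d ->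
      forall t, 0 <= t <= T -> dist3 (x t) (y t) (z t) p1 p2 p3 < e.

Definition gov_asympt_stable (alpha beta eps rho kappa : R) (p1 p2 p3 : R) : Prop :=
  gov_stable alpha beta eps rho kappa p1 p2 p3 /\
  exists eta, 0 < eta /\
    forall (x y z : R -> R),
      gov_sol_on alpha beta eps rho kappa (fun t => 0 <= t) x y z ->
      dist3 (x 0) (y 0) (z 0) p1 p2 p3 < eta ->
      is_lim x p_infty p1 /\ is_lim y p_infty p2 /\ is_lim z p_infty p3.

Definition gov_unstable (alpha beta eps rho kappa : R) (p1 p2 p3 : R) : Prop :=
  ~ gov_stable alpha beta eps rho kappa p1 p2 p3.

Definition P0x (beta : R) : R := acos beta.
Definition P0y : R := 0.
Definition P0z (beta rho kappa : R) : R :=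
  Rpower (1 - kappa * beta) (1/2) * Rpower (1 - beta ^ 2) (1/4) /
  (Rpower beta (1/2) * Rpower (rho + Rpower (1 - beta ^ 2) (1/2)) (1/2)).

Definition eps_c (alpha beta rho kappa : R) : R :=
  2 * alpha * Rpower beta (3/2) * Rpower (1 - beta ^ 2) (3/4)
    * Rpower (1 - kappa * beta) (1/2)
    * Rpower (rho + Rpower (1 - beta ^ 2) (1/2)) (3/2) /
  (Rpower (1 - beta ^ 2) (3/2) + rho * (1 - kappa * beta ^ 3)).

(* Main.v *)
(** In the coordinates [p = - (z - z0) / (alpha * sin x0)], [q = x - x0] and
    [h = y + eps * q] centred at the equilibrium, the system is a quadratic
    perturbation of [p' = q], [q' = h - eps q], [h' = - c p - a q] with
    [a, c > 0], and [eps_c = c / a] is the Routh-Hurwitz threshold.  Put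
    [Delta = a eps - c].  The form [V = a h^2 + (c p + a q)^2 + Delta c p^2]
    satisfies [V' = - 2 Delta a q^2] along the linear flow, and a small multiple
    of [(p - q) h] turns this into a definite form.  If [Delta > 0], the result is
    a strict Lyapunov function, which gives exponential decay.  If [Delta < 0],
    then [V] still takes positive values arbitrarily close to the equilibrium and
    grows exponentially along solutions starting there, so that they leave a fixed
    neighbourhood (Chetaev's argument); those solutions are obtained by Picard
    iteration after truncating [z] away from the equilibrium, which makes the
    vector field globally Lipschitz. *)

Require Import Defs.
From Stdlib Require Import Reals Lra Lia.
From Coquelicot Require Import Coquelicot.
Open Scope R_scope.

(** * Scalar differential inequalities *)

Lemma is_derive_continuous (f : R -> R) (t d : R) :
  is_derive f t d -> continuous f t.
Proof. intros H; apply (ex_derive_continuous f); now exists d. Qed.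

(** The time is the supremum of those [t] for which [phi] stays below [v] on all of [[0, t]]. By
    continuity, [phi t1 < v] would prolong such an interval past [t1], and [phi t1 > v] would
    already hold shortly before [t1]. *)
Lemma first_hitting_time (phi : R -> R) (T v : R) :
  0 <= T -> (forall t, 0 <= t <= T -> continuous phi t) ->
  phi 0 < v -> v <= phi T ->
  exists t1, 0 <= t1 <= T /\ phi t1 = v /\ forall t, 0 <= t < t1 -> phi t < v.
Proof.
  intros HT Hc H0 HvT.
  set (E := fun t => 0 <= t <= T /\ forall s, 0 <= s <= t -> phi s < v).
  destruct (completeness E) as [t1 [Hub Hlub]].
  { exists T; intros t [Ht _]; lra. }
  { exists 0; split; [lra|]; intros s Hs; now replace s with 0 by lra. }
  assert (E0 : E 0).
  { split; [lra|]; intros s Hs; now replace s with 0 by lra. }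
  assert (Ht1 : 0 <= t1 <= T).
  { split; [now apply Hub|]; apply Hlub; intros t [Ht _]; lra. }
  assert (Hbelow : forall t, 0 <= t < t1 -> phi t < v).
  { intros t Ht.
    destruct (Rlt_or_le (phi t) v) as [|Hge]; [assumption|exfalso].
    assert (is_upper_bound E t) as Hu.
    { intros s [Hs HsE]; destruct (Rle_or_lt s t) as [|Hlt]; [assumption|].
      specialize (HsE t ltac:(lra)); lra. }
    specialize (Hlub _ Hu); lra. }
  exists t1; split; [assumption|split; [|assumption]].
  destruct (Rtotal_order (phi t1) v) as [Hlt|[Heq|Hgt]]; [exfalso|assumption|exfalso].
  - assert (t1 < T) as HltT.
    { destruct (Rle_lt_or_eq_dec t1 T (proj2 Ht1)) as [|Heq]; [assumption|].
      rewrite Heq in Hlt; lra. }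
    destruct (Hc t1 Ht1 _ (open_lt v _ Hlt)) as [eps Heps].
    assert (Hpos := cond_pos eps).
    set (t2 := Rmin (t1 + eps / 2) T).
    assert (Ht2 : t1 < t2 <= t1 + eps / 2 /\ t2 <= T).
    { unfold t2; repeat split; [apply Rmin_glb_lt; lra|apply Rmin_l|apply Rmin_r]. }
    assert (E t2) as Ht2E.
    { split; [lra|]; intros s Hs.
      destruct (Rlt_or_le s t1) as [Hs1|Hs1]; [apply Hbelow; lra|].
      apply Heps; change (Rabs (s - t1) < eps); rewrite Rabs_pos_eq; lra. }
    specialize (Hub _ Ht2E); lra.
  - assert (0 < t1) as Hpos1.
    { destruct (Rle_lt_or_eq_dec 0 t1 (proj1 Ht1)) as [|Heq]; [assumption|].
      rewrite <- Heq in Hgt; lra. }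
    destruct (Hc t1 Ht1 _ (open_gt v _ Hgt)) as [eps Heps].
    assert (Hpos := cond_pos eps).
    set (t2 := Rmax (t1 - eps / 2) 0).
    assert (Ht2 : t1 - eps / 2 <= t2 < t1 /\ 0 <= t2).
    { unfold t2; repeat split; [apply Rmax_l|apply Rmax_lub_lt; lra|apply Rmax_r]. }
    assert (v < phi t2) as H2.
    { apply Heps; change (Rabs (t2 - t1) < eps).
      rewrite Rabs_minus_sym, Rabs_pos_eq; lra. }
    specialize (Hbelow t2 ltac:(lra)); lra.
Qed.

Lemma derive_nonneg_le (f : R -> R) (a b : R) :
  a <= b ->
  (forall t, a <= t <= b -> exists d, is_derive f t d /\ 0 <= d) ->
  f a <= f b.
Proof.
  intros Hab Hd.
  destruct (MVT_gen f a b (Derive f)) as [c [Hc Heq]];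
    rewrite ?Rmin_left, ?Rmax_right in * by lra.
  - intros t Ht; destruct (Hd t ltac:(lra)) as [d [Hdt _]].
    apply Derive_correct; now exists d.
  - intros t Ht; destruct (Hd t Ht) as [d [Hdt _]].
    apply continuity_pt_filterlim; exact (is_derive_continuous _ _ _ Hdt).
  - destruct (Hd c Hc) as [d [Hdc Hpos]].
    rewrite (is_derive_unique _ _ _ Hdc) in Heq; nra.
Qed.

Lemma exp_le_compat (x y : R) : x <= y -> exp x <= exp y.
Proof.
  intros [H| ->]; [apply Rlt_le, exp_increasing, H|apply Rle_refl].
Qed.

(** Gronwall by an integrating factor: [f t * exp (- k * t)] has nonnegative derivative. The signs
    of [f] and [k] are free, so decay estimates follow by applying it to [- f] and [- k]. *)
Lemma exponential_lower_bound (f : R -> R) (k T : R) :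
  0 <= T ->
  (forall t, 0 <= t <= T -> exists d, is_derive f t d /\ k * f t <= d) ->
  f 0 * exp (k * T) <= f T.
Proof.
  intros HT Hd.
  assert (H : f 0 * exp (- k * 0) <= f T * exp (- k * T)).
  { apply (derive_nonneg_le (fun t => f t * exp (- k * t))); [assumption|].
    intros t Ht; destruct (Hd t Ht) as [d [Hdt Hle]].
    exists ((d - k * f t) * exp (- k * t)); split.
    - auto_derive; [now exists d|].
      rewrite (is_derive_unique (fun s : R => f s) _ _ Hdt); ring.
    - apply Rmult_le_pos; [lra|apply Rlt_le, exp_pos]. }
  rewrite Rmult_0_r, exp_0, Rmult_1_r in H.
  apply Rle_trans with (f T * exp (- k * T) * exp (k * T)).
  - apply Rmult_le_compat_r; [apply Rlt_le, exp_pos|assumption].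
  - rewrite Rmult_assoc, <- exp_plus.
    replace (- k * T + k * T) with 0 by ring; rewrite exp_0; lra.
Qed.

(* The differential inequality is only assumed below the level [v]: the
   function cannot reach that level since it decreases until it does. *)
Lemma exponential_decay_below (f : R -> R) (k v T : R) :
  0 <= k -> 0 <= T -> 0 <= f 0 < v ->
  (forall t, 0 <= t <= T ->
     exists d, is_derive f t d /\ (f t <= v -> d <= - k * f t)) ->
  forall t, 0 <= t <= T -> f t <= f 0 * exp (- k * t).
Proof.
  intros Hk HT Hv Hd.
  (* Conditional decay: while the level [v] has not been exceeded, the inequality is available on
     all of [[0, T']]. *)
  assert (Hdecay : forall T', 0 <= T' <= T -> (forall t, 0 <= t <= T' -> f t <= v) ->
            f T' <= f 0 * exp (- k * T')).
  { intros T' HT' Hle.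
    assert (H := exponential_lower_bound (fun t => - f t) (- k) T' (proj1 HT')).
    simpl in H; enough (- f 0 * exp (- k * T') <= - f T') by lra.
    apply H; intros t Ht; destruct (Hd t ltac:(lra)) as [d [Hdt Hdle]].
    exists (- d); split; [now apply (is_derive_opp f)|].
    specialize (Hdle (Hle t Ht)); lra. }
  assert (Hbelow : forall t, 0 <= t <= T -> f t < v).
  { intros t Ht; destruct (Rlt_or_le (f t) v) as [|Hge]; [assumption|exfalso].
    (* At a first hitting time the conditional decay gives [v = f t1 <= f 0 < v]. *)
    destruct (first_hitting_time f t v) as [t1 [Ht1 [Hv1 Hlt1]]]; try tauto.
    - intros s Hs; destruct (Hd s ltac:(lra)) as [d [Hds _]].
      exact (is_derive_continuous _ _ _ Hds).
    - assert (H := Hdecay t1 ltac:(lra)).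
      assert (exp (- k * t1) <= 1).
      { rewrite <- exp_0; apply exp_le_compat; nra. }
      enough (f t1 <= f 0 * exp (- k * t1)) by nra.
      apply H; intros s Hs.
      destruct (Rle_lt_or_eq_dec s t1 (proj2 Hs)) as [Hlt| ->]; [|lra].
      apply Rlt_le, Hlt1; lra. }
  intros t Ht; apply Hdecay; [assumption|].
  intros s Hs; apply Rlt_le, Hbelow; lra.
Qed.

(** * Global solutions of Lipschitz systems *)

Lemma cosh_ge_1 (t : R) : 1 <= cosh t.
Proof.
  unfold cosh; assert (H := exp_ineq1_le t); assert (H' := exp_ineq1_le (- t)); lra.
Qed.

Lemma Rabs_sinh_le_cosh (t : R) : Rabs (sinh t) <= cosh t.
Proof.
  unfold cosh, sinh; assert (H := exp_pos t); assert (H' := exp_pos (- t)).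
  apply Rabs_le; lra.
Qed.

(** The antiderivative [g] of the bound that vanishes at [0] makes [g - f] and [g + f]
    nondecreasing, so [f] is dominated by [Rabs (g t)] in both time directions. Since [cosh] also
    dominates [sinh], integration reproduces the weight and gains the factor [1 / k]. *)
Lemma Rabs_le_cosh_of_derive (f : R -> R) (M k : R) :
  0 < k -> f 0 = 0 ->
  (forall t, exists d, is_derive f t d /\ Rabs d <= M * cosh (k * t)) ->
  forall t, Rabs (f t) <= M / k * cosh (k * t).
Proof.
  intros Hk Hf0 Hd t.
  assert (HM : 0 <= M).
  { destruct (Hd 0) as [d [_ H]]; rewrite Rmult_0_r, cosh_0 in H.
    assert (H' := Rabs_pos d); lra. }
  set (g := fun s => M / k * sinh (k * s)).
  assert (Hg0 : g 0 = 0) by (unfold g; rewrite Rmult_0_r, sinh_0; ring).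
  assert (Hg : forall s, is_derive g s (M * cosh (k * s))).
  { intros s; unfold g, sinh, cosh; auto_derive; [trivial|field; lra]. }
  assert (Hminus : forall a b, a <= b -> g a - f a <= g b - f b).
  { intros a b Hab; apply (derive_nonneg_le (fun s => g s - f s)); [assumption|].
    intros s _; destruct (Hd s) as [d [Hds Hle]].
    exists (M * cosh (k * s) - d); split; [now apply (is_derive_minus g f)|].
    apply Rabs_le_between in Hle; lra. }
  assert (Hplus : forall a b, a <= b -> g a + f a <= g b + f b).
  { intros a b Hab; apply (derive_nonneg_le (fun s => g s + f s)); [assumption|].
    intros s _; destruct (Hd s) as [d [Hds Hle]].
    exists (M * cosh (k * s) + d); split; [now apply (is_derive_plus g f)|].
    apply Rabs_le_between in Hle; lra. }
  assert (Hfg : Rabs (f t) <= Rabs (g t)).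
  { destruct (Rle_or_lt 0 t) as [Ht|Ht].
    - specialize (Hminus 0 t Ht); specialize (Hplus 0 t Ht).
      rewrite (Rabs_pos_eq (g t)) by lra; apply Rabs_le; lra.
    - specialize (Hminus t 0 ltac:(lra)); specialize (Hplus t 0 ltac:(lra)).
      rewrite (Rabs_left1 (g t)) by lra; apply Rabs_le; lra. }
  apply Rle_trans with (1 := Hfg).
  unfold g; rewrite Rabs_mult.
  assert (0 <= M / k) by (apply Rdiv_le_0_compat; lra).
  rewrite (Rabs_pos_eq (M / k)) by assumption.
  apply Rmult_le_compat_l; [assumption|apply Rabs_sinh_le_cosh].
Qed.

Fixpoint picard {I : Type} (F : I -> (I -> R) -> R) (p : I -> R) (n : nat)
    : I -> R -> R :=
  match n with
  | O => fun i _ => p i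
  | S m => fun i t => p i + RInt (fun s => F i (fun j => picard F p m j s)) 0 t
  end.

(* Componentwise continuity need not be preserved when [I] is infinite. *)
Definition preserves_continuity {I : Type} (F : I -> (I -> R) -> R) : Prop :=
  forall X : I -> R -> R, (forall i t, continuous (X i) t) ->
  forall i t, continuous (fun s => F i (fun j => X j s)) t.

(** The Lipschitz condition in the supremum norm, phrased through an upper bound [d] so that no
    supremum over [I] has to be formed. *)
Definition sup_lipschitz {I : Type} (L : R) (F : I -> (I -> R) -> R) : Prop :=
  forall i u v d, (forall j, Rabs (u j - v j) <= d) ->
  Rabs (F i u - F i v) <= L * d.

(** Continuity of the integrand is a hypothesis because the continuity of the iterates is itself
    deduced from this formula by induction. *)
Lemma picard_derive_of_continuous {I : Type} (F : I -> (I -> R) -> R) p n i t :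
  (forall s, continuous (fun s => F i (fun j => picard F p n j s)) s) ->
  is_derive (picard F p (S n) i) t (F i (fun j => picard F p n j t)).
Proof.
  intros Hc; simpl.
  set (G := fun s => F i (fun j => picard F p n j s)).
  change (is_derive (fun t => p i + RInt G 0 t) t (G t)).
  replace (G t) with (0 + G t) by ring.
  apply (is_derive_plus (fun _ => p i) (fun t => RInt G 0 t)).
  - apply (is_derive_const (p i)).
  - apply is_derive_RInt with (a := 0); [|apply Hc].
    apply filter_forall; intros b.
    apply (RInt_correct (V := R_CompleteNormedModule)), ex_RInt_continuous.
    intros z _; apply Hc.
Qed.

Lemma picard_continuous {I : Type} (F : I -> (I -> R) -> R) p n i t :
  preserves_continuity F -> continuous (picard F p n i) t.
Proof.
  intros HF; revert i t; induction n as [|n IH]; intros i t.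
  - apply continuous_const.
  - apply is_derive_continuous with (F i (fun j => picard F p n j t)).
    apply picard_derive_of_continuous; intros s; apply HF, IH.
Qed.

Lemma picard_derive {I : Type} (F : I -> (I -> R) -> R) p n i t :
  preserves_continuity F ->
  is_derive (picard F p (S n) i) t (F i (fun j => picard F p n j t)).
Proof.
  intros HF; apply picard_derive_of_continuous; intros s.
  apply HF; intros; now apply picard_continuous.
Qed.

Lemma picard_0 {I : Type} (F : I -> (I -> R) -> R) p n i : picard F p n i 0 = p i.
Proof.
  destruct n; simpl; [reflexivity|].
  rewrite RInt_point; apply Rplus_0_r.
Qed.

(* The weight [cosh (2 L t)] makes one Picard step a contraction by 1/2. *)
Lemma picard_step {I : Type} (F : I -> (I -> R) -> R) p L M :
  0 < L -> preserves_continuity F -> sup_lipschitz L F ->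
  (forall i, Rabs (F i p) <= M) ->
  forall n i t, Rabs (picard F p (S n) i t - picard F p n i t)
    <= M / (2 * L) * (1 / 2) ^ n * cosh (2 * L * t).
Proof.
  intros HL Hc HF HM n; induction n as [|n IH]; intros i t.
  - replace (M / (2 * L) * (1 / 2) ^ 0) with (M / (2 * L)) by (simpl; ring).
    apply (Rabs_le_cosh_of_derive
             (fun t => picard F p 1 i t - picard F p 0 i t)); [lra| |].
    + rewrite !picard_0; ring.
    + intros s; exists (F i p - 0); split.
      * apply (is_derive_minus (picard F p 1 i) (picard F p 0 i)).
        -- exact (picard_derive F p 0 i s Hc).
        -- apply (is_derive_const (p i)).
      * rewrite Rminus_0_r; specialize (HM i); assert (H := cosh_ge_1 (2 * L * s)).
        assert (H' := Rabs_pos (F i p)); nra.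
  - replace (M / (2 * L) * (1 / 2) ^ S n)
      with (L * (M / (2 * L) * (1 / 2) ^ n) / (2 * L)) by (simpl; field; lra).
    apply (Rabs_le_cosh_of_derive
             (fun t => picard F p (S (S n)) i t - picard F p (S n) i t)); [lra| |].
    + rewrite !picard_0; ring.
    + intros s.
      exists (F i (fun j => picard F p (S n) j s) - F i (fun j => picard F p n j s)).
      split.
      * apply (is_derive_minus (picard F p (S (S n)) i) (picard F p (S n) i));
          now apply picard_derive.
      * rewrite Rmult_assoc; apply HF; intros j; apply IH.
Qed.

Lemma geometric_steps_cauchy (u : nat -> R) (C : R) :
  (forall n, Rabs (u (S n) - u n) <= C * (1 / 2) ^ n) ->
  forall n k, Rabs (u (n + k)%nat - u n) <= 2 * C * (1 / 2) ^ n.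
Proof.
  intros H.
  assert (HC : 0 <= C).
  { specialize (H O); assert (H' := Rabs_pos (u 1%nat - u 0%nat)); simpl in H; lra. }
  (* The partial geometric sum is kept exact: the bound [2 * C * (1 / 2) ^ n] alone does not pass
     from [k] to [k + 1]. *)
  assert (Hk : forall n k, Rabs (u (n + k)%nat - u n)
                 <= 2 * C * ((1 / 2) ^ n - (1 / 2) ^ (n + k))).
  { intros n k; induction k as [|k IH].
    - rewrite Nat.add_0_r, Rminus_diag, Rabs_R0; lra.
    - rewrite Nat.add_succ_r.
      replace (u (S (n + k)) - u n)
        with ((u (S (n + k)) - u (n + k)%nat) + (u (n + k)%nat - u n)) by ring.
      apply Rle_trans with (1 := Rabs_triang _ _).
      specialize (H (n + k)%nat); simpl; lra. }
  intros n k; apply Rle_trans with (1 := Hk n k).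
  assert (0 < (1 / 2) ^ (n + k)) by (apply pow_lt; lra); nra.
Qed.

Lemma geometric_small (C e : R) :
  0 < e -> exists N, forall n, (N <= n)%nat -> C * (1 / 2) ^ n < e.
Proof.
  intros He.
  destruct (pow_lt_1_zero (1 / 2) ltac:(rewrite Rabs_pos_eq; lra)
              (e / (Rabs C + 1))) as [N HN].
  { apply Rdiv_lt_0_compat; [assumption|]; assert (H := Rabs_pos C); lra. }
  exists N; intros n Hn; specialize (HN n Hn).
  assert (HC := Rabs_pos C); assert (HC' := Rle_abs C).
  assert (Hp : 0 < (1 / 2) ^ n) by (apply pow_lt; lra).
  rewrite Rabs_pos_eq in HN by lra.
  apply Rmult_lt_compat_r with (r := Rabs C + 1) in HN; [|lra].
  unfold Rdiv in HN at 2; rewrite Rmult_assoc, Rinv_l, Rmult_1_r in HN by lra.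
  nra.
Qed.

(** The Picard iterates converge geometrically, uniformly on bounded time intervals. By the
    Lipschitz condition so do their derivatives, and the limit may be differentiated termwise. *)
Theorem lipschitz_global_solution {I : Type} (F : I -> (I -> R) -> R) p L M :
  0 < L -> preserves_continuity F -> sup_lipschitz L F ->
  (forall i, Rabs (F i p) <= M) ->
  exists X : I -> R -> R, (forall i, X i 0 = p i) /\
    forall i t, is_derive (X i) t (F i (fun j => X j t)).
Proof.
  intros HL Hc HF HM.
  assert (Hstep := picard_step F p L M HL Hc HF HM).
  set (W := fun t => M / (2 * L) * cosh (2 * L * t)).
  assert (Hcau : forall i t n k, Rabs (picard F p (n + k) i t - picard F p n i t)
                   <= 2 * W t * (1 / 2) ^ n).
  { intros i t; apply (geometric_steps_cauchy (fun n => picard F p n i t)).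
    intros n; unfold W; specialize (Hstep n i t); lra. }
  assert (Hlim : forall i t, is_lim_seq (fun n => picard F p n i t)
                   (real (Lim_seq (fun n => picard F p n i t)))).
  { intros i t; apply Lim_seq_correct', ex_lim_seq_cauchy_corr.
    intros e; destruct (geometric_small (2 * W t) (e / 2)) as [N HN].
    { apply is_pos_div_2. }
    exists N; intros n m Hn Hm.
    specialize (HN N (Nat.le_refl N)).
    assert (H1 := Hcau i t N (n - N)%nat); assert (H2 := Hcau i t N (m - N)%nat).
    replace (N + (n - N))%nat with n in H1 by lia.
    replace (N + (m - N))%nat with m in H2 by lia.
    apply Rabs_le_between in H1; apply Rabs_le_between in H2.
    apply Rabs_def1; lra. }
  exists (fun i t => real (Lim_seq (fun n => picard F p n i t))).
  set (X := fun i t => real (Lim_seq (fun n => picard F p n i t))).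
  assert (HX : forall i t n, Rabs (X i t - picard F p n i t) <= 2 * W t * (1 / 2) ^ n).
  { intros i t n.
    assert (H : is_lim_seq (fun k => Rabs (picard F p (k + n) i t - picard F p n i t))
                  (Rabs (X i t - picard F p n i t))).
    { apply (is_lim_seq_abs _ (Finite (X i t - picard F p n i t))).
      apply is_lim_seq_minus'; [|apply is_lim_seq_const].
      apply (is_lim_seq_incr_n (fun k => picard F p k i t)), Hlim. }
    refine (is_lim_seq_le _ _ _ (Finite (2 * W t * (1 / 2) ^ n)) _ H
              (is_lim_seq_const _)).
    intros k; rewrite Nat.add_comm; apply Hcau. }
  split.
  - intros i; unfold X.
    rewrite (Lim_seq_ext _ (fun _ => p i)) by (intros; apply picard_0).
    now rewrite Lim_seq_const.
  - intros i t.
    change (is_derive (X i) t (F i (fun j => X j t))).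
    apply is_derive_Reals.
    assert (Hr : 0 < Rabs t + 1) by (assert (H := Rabs_pos t); lra).
    set (r := mkposreal _ Hr).
    (* The sequence is shifted by one because the derivative of an iterate is the field along the
       preceding one. *)
    apply (CVU_derivable (fun n => picard F p (S n) i)
             (fun n t => F i (fun j => picard F p n j t))
             (X i) (fun t => F i (fun j => X j t)) 0 r).
    + intros e He.
      (* [B] bounds the weight [W] on the whole ball of radius [r]. *)
      set (B := M / (2 * L) * exp (2 * L * r)).
      destruct (geometric_small (L * (2 * B)) e He) as [N HN].
      exists N; intros n s Hn Hs; specialize (HN n Hn).
      apply Rle_lt_trans with (2 := HN).
      rewrite Rmult_assoc; apply HF; intros j.
      apply Rle_trans with (1 := HX j s n).
      apply Rmult_le_compat_r; [apply pow_le; lra|].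
      apply Rmult_le_compat_l; [lra|]; unfold W, B.
      assert (HM0 : 0 <= M) by
        (apply Rle_trans with (2 := HM i), Rabs_pos).
      apply Rmult_le_compat_l; [apply Rdiv_le_0_compat; lra|].
      unfold Boule in Hs; rewrite Rminus_0_r in Hs.
      apply Rabs_def2 in Hs.
      assert (exp (2 * L * s) <= exp (2 * L * r)) by (apply exp_le_compat; nra).
      assert (exp (- (2 * L * s)) <= exp (2 * L * r)) by (apply exp_le_compat; nra).
      unfold cosh; lra.
    + intros s _; apply is_lim_seq_Reals.
      apply (is_lim_seq_incr_1 (fun n => picard F p n i s)), Hlim.
    + intros n s _; apply is_derive_Reals; now apply picard_derive.
    + unfold Boule; simpl; rewrite Rminus_0_r; lra.
Qed.

(** * Perturbed third-order linear equations *)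

Definition sq3 (p q h : R) : R := p ^ 2 + q ^ 2 + h ^ 2.

(* A quadratic perturbation of [p''' + e p'' + a p' + c p = 0], written with
   [q = p'] and [h = p'' + e p']. *)
Definition near_jerk (a c e K : R) (p q h : R -> R) (t : R) : Prop :=
  exists n1 n2,
    is_derive p t (q t + n1) /\
    is_derive q t (h t - e * q t) /\
    is_derive h t (- c * p t - a * q t + n2) /\
    (sq3 (p t) (q t) (h t) <= 1 ->
       Rabs n1 <= K * sq3 (p t) (q t) (h t) /\ Rabs n2 <= K * sq3 (p t) (q t) (h t)).

(* For [eta = 0] the derivative along the linear flow is [-2 (a e - c) a q^2];
   the cross term makes it definite in the two other directions. *)
Definition lyap (a c e eta p q h : R) : R :=
  a * h ^ 2 + (c * p + a * q) ^ 2 + (a * e - c) * c * p ^ 2 + eta * (p - q) * h.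

(** The derivative of [(p - q) * h] along the linear flow. *)
Definition cross_rate (a c e p q h : R) : R :=
  - c * p ^ 2 - h ^ 2 + (1 + e) * q * h + (c - a) * p * q + a * q ^ 2.

Lemma lyap_derive (a c e eta : R) (p q h : R -> R) (t n1 n2 : R) :
  is_derive p t (q t + n1) ->
  is_derive q t (h t - e * q t) ->
  is_derive h t (- c * p t - a * q t + n2) ->
  is_derive (fun t => lyap a c e eta (p t) (q t) (h t)) t
    (- 2 * (a * e - c) * a * q t ^ 2 + eta * cross_rate a c e (p t) (q t) (h t)
     + (2 * c * (c * p t + a * q t) + 2 * (a * e - c) * c * p t + eta * h t) * n1
     + (2 * a * h t + eta * (p t - q t)) * n2).
Proof.
  intros Hp Hq Hh; unfold lyap, cross_rate.
  auto_derive.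
  - repeat split; eexists; eassumption.
  - rewrite (is_derive_unique (fun s : R => p s) _ _ Hp),
      (is_derive_unique (fun s : R => q s) _ _ Hq),
      (is_derive_unique (fun s : R => h s) _ _ Hh); ring.
Qed.

(** The cross rate is negative in [p] and [h] up to a multiple of [q ^ 2], which the dissipation
    absorbs once [eta] is small. Decay uses this with [D = a e - c], growth with [D = - (a e - c)];
    the bound [eta0] leaves room to preserve positivity of the form. *)
Lemma cross_rate_strict (a c e D eta0 : R) :
  0 < a -> 0 < c -> 0 < D -> 0 < eta0 ->
  exists eta delta, 0 < eta <= eta0 /\ 0 < delta /\
    forall p q h,
      - 2 * D * a * q ^ 2 + eta * cross_rate a c e p q h <= - delta * sq3 p q h.
Proof.
  intros Ha Hc HD H0.
  (* [K] collects the [q ^ 2] terms left by completing squares in [(1 + e) * q * h] and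
     [(c - a) * p * q], at the cost of half of [h ^ 2] and of [c * p ^ 2]. *)
  set (K := (1 + e) ^ 2 / 2 + (c - a) ^ 2 / (2 * c) + a).
  assert (HK : 0 < K).
  { unfold K; assert (0 <= (1 + e) ^ 2) by apply pow2_ge_0.
    assert (0 <= (c - a) ^ 2 / (2 * c))
      by (apply Rdiv_le_0_compat; [apply pow2_ge_0|lra]); lra. }
  assert (Hrate : forall p q h,
            cross_rate a c e p q h <= - (c / 2) * p ^ 2 - h ^ 2 / 2 + K * q ^ 2).
  { intros p q h; unfold cross_rate, K.
    assert (0 <= (h - (1 + e) * q) ^ 2) by apply pow2_ge_0.
    assert (0 <= (c * p - (c - a) * q) ^ 2 / (2 * c))
      by (apply Rdiv_le_0_compat; [apply pow2_ge_0|lra]).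
    replace ((c * p - (c - a) * q) ^ 2 / (2 * c))
      with (c / 2 * p ^ 2 - (c - a) * p * q + (c - a) ^ 2 / (2 * c) * q ^ 2)
      in * by (field; lra).
    nra. }
  assert (HDa : 0 < D * a) by now apply Rmult_lt_0_compat.
  set (eta := Rmin eta0 (D * a / K)).
  assert (Heta : 0 < eta).
  { apply Rmin_glb_lt; [assumption|now apply Rdiv_lt_0_compat]. }
  assert (HetaK : eta * K <= D * a).
  { replace (D * a) with (D * a / K * K) by (field; lra).
    apply Rmult_le_compat_r; [lra|apply Rmin_r]. }
  (* The least coefficient that remains in front of [q ^ 2], [p ^ 2] and [h ^ 2]; half of
     [2 * D * a] has been spent on [eta * K]. *)
  set (delta := Rmin (D * a) (Rmin (eta * c / 2) (eta / 2))).
  assert (Hd1 : delta <= D * a) by apply Rmin_l.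
  assert (Hd2 : delta <= eta * c / 2)
    by (apply Rle_trans with (1 := Rmin_r _ _), Rmin_l).
  assert (Hd3 : delta <= eta / 2)
    by (apply Rle_trans with (1 := Rmin_r _ _), Rmin_r).
  assert (Hd : 0 < delta).
  { repeat apply Rmin_glb_lt; [assumption|nra|lra]. }
  exists eta, delta; split; [split; [assumption|apply Rmin_l]|split; [assumption|]].
  intros p q h; unfold sq3.
  assert (Hp := pow2_ge_0 p); assert (Hq := pow2_ge_0 q); assert (Hh := pow2_ge_0 h).
  apply Rle_trans with
    (- 2 * D * a * q ^ 2 + eta * (- (c / 2) * p ^ 2 - h ^ 2 / 2 + K * q ^ 2)).
  { apply Rplus_le_compat_l, Rmult_le_compat_l; [lra|apply Hrate]. }
  assert (eta * K * q ^ 2 <= D * a * q ^ 2) by now apply Rmult_le_compat_r.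
  assert (delta * q ^ 2 <= D * a * q ^ 2) by now apply Rmult_le_compat_r.
  assert (delta * p ^ 2 <= eta * c / 2 * p ^ 2) by now apply Rmult_le_compat_r.
  assert (delta * h ^ 2 <= eta / 2 * h ^ 2) by now apply Rmult_le_compat_r.
  lra.
Qed.

Lemma cross_term_le (p q h : R) : Rabs ((p - q) * h) <= sq3 p q h.
Proof.
  assert (H1 := pow2_ge_0 (p + h)); assert (H2 := pow2_ge_0 (p - h)).
  assert (H3 := pow2_ge_0 (q + h)); assert (H4 := pow2_ge_0 (q - h)).
  assert (H5 := pow2_ge_0 p); assert (H6 := pow2_ge_0 q).
  unfold sq3; apply Rabs_le; lra.
Qed.

(** For [eta = 0] the form is a positive combination of the squares of [h], [c * p + a * q] and [p],
    which are independent. Half of its lower bound [m0] pays for the cross term, so one constant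
    bounds both the form and [eta]. *)
Lemma lyap_posdef (a c e : R) :
  0 < a -> 0 < c -> 0 < a * e - c ->
  exists m, 0 < m /\ forall eta p q h, 0 <= eta <= m ->
    m * sq3 p q h <= lyap a c e eta p q h.
Proof.
  intros Ha Hc HD.
  set (d := (a * e - c) * c).
  assert (Hd : 0 < d) by now apply Rmult_lt_0_compat.
  (* Scaled from [a ^ 2 * q ^ 2 <= 2 * (c * p + a * q) ^ 2 + 2 * c ^ 2 * p ^ 2]: the two entries
     bring the coefficients down to [1] and [d / 2], which leaves [d / 2] for [p ^ 2]. *)
  set (l := Rmin (a ^ 2 / 2) (d * a ^ 2 / (4 * c ^ 2))).
  assert (Ha2 : 0 < a ^ 2) by now apply pow_lt.
  assert (Hc2 : 0 < c ^ 2) by now apply pow_lt.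
  assert (Hl : 0 < l).
  { apply Rmin_glb_lt; [lra|].
    apply Rdiv_lt_0_compat; [now apply Rmult_lt_0_compat|lra]. }
  assert (Hl1 : 2 * l / a ^ 2 <= 1).
  { assert (l <= a ^ 2 / 2) by apply Rmin_l.
    apply Rmult_le_reg_r with (a ^ 2); [assumption|].
    unfold Rdiv; rewrite Rmult_assoc, Rinv_l by lra; lra. }
  assert (Hl2 : 2 * l * c ^ 2 / a ^ 2 <= d / 2).
  { apply Rmult_le_reg_r with (a ^ 2 / (2 * c ^ 2)).
    { apply Rdiv_lt_0_compat; lra. }
    replace (2 * l * c ^ 2 / a ^ 2 * (a ^ 2 / (2 * c ^ 2))) with l by (field; lra).
    replace (d / 2 * (a ^ 2 / (2 * c ^ 2))) with (d * a ^ 2 / (4 * c ^ 2))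
      by (field; lra).
    apply Rmin_r. }
  set (m0 := Rmin l (Rmin (d / 2) a)).
  assert (Hm1 : m0 <= l) by apply Rmin_l.
  assert (Hm2 : m0 <= d / 2) by (apply Rle_trans with (1 := Rmin_r _ _), Rmin_l).
  assert (Hm3 : m0 <= a) by (apply Rle_trans with (1 := Rmin_r _ _), Rmin_r).
  assert (Hm0 : 0 < m0) by (apply Rmin_glb_lt; [|apply Rmin_glb_lt]; lra).
  exists (m0 / 2); split; [lra|]; intros eta p q h Heta.
  assert (Hcross := cross_term_le p q h); apply Rabs_le_between in Hcross.
  unfold lyap; fold d.
  assert (Hp := pow2_ge_0 p); assert (Hq := pow2_ge_0 q); assert (Hh := pow2_ge_0 h).
  assert (Hg := pow2_ge_0 (c * p + a * q)).
  assert (Hq' : l * q ^ 2 <= (c * p + a * q) ^ 2 + d / 2 * p ^ 2).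
  { apply Rle_trans with
      (2 * l / a ^ 2 * (c * p + a * q) ^ 2 + 2 * l * c ^ 2 / a ^ 2 * p ^ 2).
    - replace (2 * l / a ^ 2 * (c * p + a * q) ^ 2 + 2 * l * c ^ 2 / a ^ 2 * p ^ 2)
        with (l * q ^ 2 + l / a ^ 2 * (2 * c * p + a * q) ^ 2) by (field; lra).
      assert (0 <= l / a ^ 2 * (2 * c * p + a * q) ^ 2).
      { apply Rmult_le_pos; [apply Rdiv_le_0_compat; lra|apply pow2_ge_0]. }
      lra.
    - apply Rplus_le_compat.
      + rewrite <- (Rmult_1_l ((c * p + a * q) ^ 2)) at 2.
        now apply Rmult_le_compat_r.
      + now apply Rmult_le_compat_r. }
  assert (m0 * q ^ 2 <= l * q ^ 2) by now apply Rmult_le_compat_r.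
  assert (m0 * p ^ 2 <= d / 2 * p ^ 2) by now apply Rmult_le_compat_r.
  assert (m0 * h ^ 2 <= a * h ^ 2) by now apply Rmult_le_compat_r.
  assert (- (m0 / 2) * sq3 p q h <= eta * ((p - q) * h)).
  { assert (0 <= sq3 p q h) by (unfold sq3; lra); nra. }
  unfold sq3 in *; lra.
Qed.

Lemma lyap_le (a c e eta : R) :
  0 < a -> exists M, 0 < M /\ forall p q h, lyap a c e eta p q h <= M * sq3 p q h.
Proof.
  intros Ha; set (d := (a * e - c) * c).
  exists (a + 2 * c ^ 2 + 2 * a ^ 2 + Rabs d + Rabs eta).
  assert (Ha2 := pow2_ge_0 a); assert (Hc2 := pow2_ge_0 c).
  assert (Hd0 := Rabs_pos d); assert (He0 := Rabs_pos eta).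
  split; [lra|]; intros p q h.
  assert (Hp := pow2_ge_0 p); assert (Hq := pow2_ge_0 q); assert (Hh := pow2_ge_0 h).
  assert (H1 : (c * p + a * q) ^ 2 <= 2 * c ^ 2 * p ^ 2 + 2 * a ^ 2 * q ^ 2).
  { assert (H := pow2_ge_0 (c * p - a * q)); nra. }
  assert (H2 : d * p ^ 2 <= Rabs d * p ^ 2)
    by (apply Rmult_le_compat_r; [assumption|apply Rle_abs]).
  assert (H3 : eta * ((p - q) * h) <= Rabs eta * sq3 p q h).
  { apply Rle_trans with (1 := Rle_abs _); rewrite Rabs_mult.
    apply Rmult_le_compat_l; [assumption|apply cross_term_le]. }
  unfold lyap; fold d; unfold sq3 in *; nra.
Qed.

(** The partial derivatives of [lyap] in [p] and [h] are linear, hence of size [r] on the ball,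
    while [n1] and [n2] are quadratic; a small [r] makes the product a small multiple of [sq3]. *)
Lemma perturbation_le (a c e eta K delta : R) :
  0 <= K -> 0 < delta ->
  exists r, 0 < r <= 1 /\ forall p q h n1 n2, sq3 p q h <= r ^ 2 ->
    Rabs n1 <= K * sq3 p q h -> Rabs n2 <= K * sq3 p q h ->
    Rabs ((2 * c * (c * p + a * q) + 2 * (a * e - c) * c * p + eta * h) * n1
          + (2 * a * h + eta * (p - q)) * n2) <= delta * sq3 p q h.
Proof.
  intros HK Hdelta.
  set (G1 := Rabs (2 * c * c + 2 * (a * e - c) * c) + Rabs (2 * c * a) + Rabs eta).
  set (G2 := Rabs (2 * a) + 2 * Rabs eta).
  set (G := G1 + G2).
  assert (Heta := Rabs_pos eta).
  assert (HG1 : 0 <= G1).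
  { unfold G1; assert (H := Rabs_pos (2 * c * c + 2 * (a * e - c) * c)).
    assert (H' := Rabs_pos (2 * c * a)); lra. }
  assert (HG2 : 0 <= G2) by (unfold G2; assert (H := Rabs_pos (2 * a)); lra).
  assert (HGK : 0 <= G * K) by (apply Rmult_le_pos; unfold G; lra).
  (* The [1] keeps [sq3] in the range where [near_jerk] bounds the perturbations; the [+ 1] keeps
     the denominator positive when [K = 0]. *)
  set (r := Rmin 1 (delta / (G * K + 1))).
  assert (Hr : 0 < r) by (apply Rmin_glb_lt; [lra|apply Rdiv_lt_0_compat; lra]).
  assert (Hr' : G * K * r <= delta).
  { apply Rle_trans with ((G * K + 1) * r); [lra|].
    replace delta with ((G * K + 1) * (delta / (G * K + 1))) by (field; lra).
    apply Rmult_le_compat_l; [lra|apply Rmin_r]. }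
  exists r; split; [split; [assumption|apply Rmin_l]|].
  intros p q h n1 n2 HS Hn1 Hn2.
  assert (Hsmall : Rabs p <= r /\ Rabs q <= r /\ Rabs h <= r).
  { unfold sq3 in HS.
    assert (Hp := pow2_ge_0 p); assert (Hq := pow2_ge_0 q); assert (Hh := pow2_ge_0 h).
    rewrite <- (Rabs_pos_eq r) by lra.
    repeat split; apply Rsqr_le_abs_0; unfold Rsqr; lra. }
  destruct Hsmall as [Hp [Hq Hh]].
  assert (HS0 : 0 <= sq3 p q h).
  { unfold sq3; assert (H1 := pow2_ge_0 p); assert (H2 := pow2_ge_0 q).
    assert (H3 := pow2_ge_0 h); lra. }
  assert (H1 : Rabs (2 * c * (c * p + a * q) + 2 * (a * e - c) * c * p + eta * h)
               <= G1 * r).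
  { replace (2 * c * (c * p + a * q) + 2 * (a * e - c) * c * p + eta * h)
      with ((2 * c * c + 2 * (a * e - c) * c) * p + 2 * c * a * q + eta * h) by ring.
    apply Rle_trans with (1 := Rabs_triang _ _).
    apply Rle_trans with (1 := Rplus_le_compat_r _ _ _ (Rabs_triang _ _)).
    rewrite !(Rabs_mult _ p), !(Rabs_mult _ q), !(Rabs_mult _ h).
    unfold G1; rewrite !Rmult_plus_distr_r.
    repeat apply Rplus_le_compat; apply Rmult_le_compat_l; auto using Rabs_pos. }
  assert (H2 : Rabs (2 * a * h + eta * (p - q)) <= G2 * r).
  { replace (2 * a * h + eta * (p - q)) with (2 * a * h + eta * p + eta * - q) by ring.
    apply Rle_trans with (1 := Rabs_triang _ _).
    apply Rle_trans with (1 := Rplus_le_compat_r _ _ _ (Rabs_triang _ _)).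
    rewrite !(Rabs_mult _ p), !(Rabs_mult _ (- q)), !(Rabs_mult _ h), Rabs_Ropp.
    unfold G2; assert (Hr1 := Rmult_le_compat_l _ _ _ (Rabs_pos (2 * a)) Hh).
    assert (Hr2 := Rmult_le_compat_l _ _ _ Heta Hp).
    assert (Hr3 := Rmult_le_compat_l _ _ _ Heta Hq); lra. }
  apply Rle_trans with (1 := Rabs_triang _ _); rewrite !Rabs_mult.
  apply Rle_trans with (G1 * r * (K * sq3 p q h) + G2 * r * (K * sq3 p q h)).
  - apply Rplus_le_compat; apply Rmult_le_compat; auto using Rabs_pos.
  - replace (G1 * r * (K * sq3 p q h) + G2 * r * (K * sq3 p q h))
      with (G * K * r * sq3 p q h) by (unfold G; ring).
    now apply Rmult_le_compat_r.
Qed.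

Theorem near_jerk_decay (a c e K : R) :
  0 < a -> 0 < c -> 0 < a * e - c -> 0 <= K ->
  exists C k r, 0 < C /\ 0 < k /\ 0 < r /\
    forall T (p q h : R -> R), 0 <= T ->
      (forall t, 0 <= t <= T -> near_jerk a c e K p q h t) ->
      sq3 (p 0) (q 0) (h 0) < r ->
      forall t, 0 <= t <= T ->
        sq3 (p t) (q t) (h t) <= C * sq3 (p 0) (q 0) (h 0) * exp (- k * t).
Proof.
  intros Ha Hc HD HK.
  destruct (lyap_posdef a c e Ha Hc HD) as [m [Hm Hlow]].
  destruct (cross_rate_strict a c e (a * e - c) m Ha Hc HD Hm)
    as [eta [delta [Heta [Hdelta Hrate]]]].
  destruct (lyap_le a c e eta Ha) as [M [HM Hup]].
  destruct (perturbation_le a c e eta K (delta / 2) HK ltac:(lra)) as [r [Hr Hpert]].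
  set (k := delta / (2 * M)).
  assert (Hk : 0 < k) by (apply Rdiv_lt_0_compat; lra).
  assert (HkM : k * M = delta / 2) by (unfold k; field; lra).
  assert (Hr2 : 0 < r ^ 2) by (apply pow_lt; lra).
  (* [M / m] is the price of passing from [sq3] to [V] and back. The last constant starts [V] below
     the level [m * r ^ 2], under which [sq3] is at most [r ^ 2] and the perturbation is
     controlled. *)
  exists (M / m), k, (m * r ^ 2 / M).
  split; [now apply Rdiv_lt_0_compat|split; [assumption|split]].
  { apply Rdiv_lt_0_compat; [now apply Rmult_lt_0_compat|assumption]. }
  intros T p q h HT Hsol H0.
  set (V := fun t => lyap a c e eta (p t) (q t) (h t)).
  set (S := fun t => sq3 (p t) (q t) (h t)).
  assert (HS : forall t, 0 <= S t).
  { intros t; unfold S, sq3; assert (H1 := pow2_ge_0 (p t)).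
    assert (H2 := pow2_ge_0 (q t)); assert (H3 := pow2_ge_0 (h t)); lra. }
  assert (HVlow : forall t, m * S t <= V t) by (intros t; apply Hlow; lra).
  assert (HVup : forall t, V t <= M * S t) by (intros t; apply Hup).
  assert (HV : forall t, 0 <= t <= T -> V t <= V 0 * exp (- k * t)).
  { apply exponential_decay_below with (m * r ^ 2); [lra|assumption| |].
    - split.
      + apply Rle_trans with (2 := HVlow 0), Rmult_le_pos; [lra|apply HS].
      + apply Rle_lt_trans with (1 := HVup 0).
        replace (m * r ^ 2) with (M * (m * r ^ 2 / M)) by (field; lra).
        now apply Rmult_lt_compat_l.
    - intros t Ht; destruct (Hsol t Ht) as [n1 [n2 [Hp [Hq [Hh Hn]]]]].
      eexists; split; [exact (lyap_derive a c e eta p q h t n1 n2 Hp Hq Hh)|].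
      intros Hv.
      assert (HSr : S t <= r ^ 2).
      { apply Rmult_le_reg_l with m; [assumption|].
        apply Rle_trans with (2 := Hv), HVlow. }
      destruct Hn as [Hn1 Hn2].
      { apply Rle_trans with (1 := HSr); nra. }
      specialize (Hpert _ _ _ _ _ HSr Hn1 Hn2); apply Rabs_le_between in Hpert.
      specialize (Hrate (p t) (q t) (h t)).
      assert (HkV : k * V t <= delta / 2 * S t).
      { rewrite <- HkM, Rmult_assoc; apply Rmult_le_compat_l; [lra|apply HVup]. }
      unfold S in *; lra. }
  intros t Ht; change (S t <= M / m * S 0 * exp (- k * t)).
  apply Rmult_le_reg_l with m; [assumption|].
  replace (m * (M / m * S 0 * exp (- k * t))) with (M * S 0 * exp (- k * t))
    by (field; lra).
  apply Rle_trans with (1 := HVlow t), Rle_trans with (1 := HV t Ht).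
  apply Rmult_le_compat_r; [apply Rlt_le, exp_pos|apply HVup].
Qed.

(** With the cross term reversed, [V] grows exponentially while the solution stays in the ball, yet
    is bounded there. The start [p = h = 0] has [V = a ^ 2 * q ^ 2], which is positive for [q <> 0]
    although the form is indefinite. *)
Theorem near_jerk_growth (a c e K : R) :
  0 < a -> 0 < c -> a * e - c < 0 -> 0 <= K ->
  exists C k r, 0 < C /\ 0 < k /\ 0 < r /\
    forall T (p q h : R -> R), 0 <= T ->
      (forall t, 0 <= t <= T -> near_jerk a c e K p q h t) ->
      (forall t, 0 <= t <= T -> sq3 (p t) (q t) (h t) <= r) ->
      p 0 = 0 -> h 0 = 0 ->
      q 0 ^ 2 * exp (k * T) <= C.
Proof.
  intros Ha Hc HD HK.
  (* The bound [1] on [eta] is arbitrary: growth is measured from a point where the cross term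
     vanishes. *)
  destruct (cross_rate_strict a c e (- (a * e - c)) 1 Ha Hc ltac:(lra) Rlt_0_1)
    as [eta [delta [Heta [Hdelta Hrate]]]].
  destruct (lyap_le a c e (- eta) Ha) as [M [HM Hup]].
  destruct (perturbation_le a c e (- eta) K (delta / 2) HK ltac:(lra))
    as [r [Hr Hpert]].
  set (k := delta / (2 * M)).
  assert (Hk : 0 < k) by (apply Rdiv_lt_0_compat; lra).
  assert (HkM : k * M = delta / 2) by (unfold k; field; lra).
  assert (Hr2 : 0 < r ^ 2) by (apply pow_lt; lra).
  assert (Ha2 : 0 < a ^ 2) by now apply pow_lt.
  exists (M * r ^ 2 / a ^ 2), k, (r ^ 2).
  split; [|split; [assumption|split; [assumption|]]].
  { apply Rdiv_lt_0_compat; [now apply Rmult_lt_0_compat|assumption]. }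
  intros T p q h HT Hsol HSr Hp0 Hh0.
  set (V := fun t => lyap a c e (- eta) (p t) (q t) (h t)).
  assert (HV : V 0 * exp (k * T) <= V T).
  { apply exponential_lower_bound; [assumption|].
    intros t Ht; destruct (Hsol t Ht) as [n1 [n2 [Hp [Hq [Hh Hn]]]]].
    eexists; split; [exact (lyap_derive a c e (- eta) p q h t n1 n2 Hp Hq Hh)|].
    specialize (HSr t Ht).
    destruct Hn as [Hn1 Hn2].
    { apply Rle_trans with (1 := HSr); nra. }
    specialize (Hpert _ _ _ _ _ HSr Hn1 Hn2); apply Rabs_le_between in Hpert.
    specialize (Hrate (p t) (q t) (h t)).
    assert (HkV : k * V t <= delta / 2 * sq3 (p t) (q t) (h t)).
    { rewrite <- HkM, Rmult_assoc; apply Rmult_le_compat_l; [lra|apply Hup]. }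
    lra. }
  assert (HV0 : V 0 = a ^ 2 * q 0 ^ 2).
  { unfold V, lyap; rewrite Hp0, Hh0; ring. }
  assert (HVT : V T <= M * r ^ 2).
  { apply Rle_trans with (1 := Hup _ _ _).
    apply Rmult_le_compat_l; [lra|apply HSr; lra]. }
  apply Rmult_le_reg_l with (a ^ 2); [assumption|].
  replace (a ^ 2 * (M * r ^ 2 / a ^ 2)) with (M * r ^ 2) by (field; lra).
  rewrite HV0 in HV; lra.
Qed.

(** * First-order expansions *)

(** A first-order Taylor expansion with quadratic remainder on a square, stable under sums and
    products, so that the linearization of the field is assembled factor by factor. *)
Definition expands (r : R) (f : R -> R -> R) (f0 fu fw : R) : Prop :=
  exists K, 0 <= K /\ forall u w, Rabs u <= r -> Rabs w <= r ->
    Rabs (f u w - (f0 + fu * u + fw * w)) <= K * (u ^ 2 + w ^ 2).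

Lemma expands_const r k : expands r (fun _ _ => k) k 0 0.
Proof.
  exists 0; split; [lra|]; intros u w _ _.
  replace (k - (k + 0 * u + 0 * w)) with 0 by ring; rewrite Rabs_R0; lra.
Qed.

Lemma expands_translation_r r k : expands r (fun _ w => k + w) k 0 1.
Proof.
  exists 0; split; [lra|]; intros u w _ _.
  replace (k + w - (k + 0 * u + 1 * w)) with 0 by ring; rewrite Rabs_R0; lra.
Qed.

Lemma expands_plus r f f0 fu fw g g0 gu gw :
  expands r f f0 fu fw -> expands r g g0 gu gw ->
  expands r (fun u w => f u w + g u w) (f0 + g0) (fu + gu) (fw + gw).
Proof.
  intros [Kf [HKf Hf]] [Kg [HKg Hg]]; exists (Kf + Kg); split; [lra|].
  intros u w Hu Hw; specialize (Hf u w Hu Hw); specialize (Hg u w Hu Hw).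
  replace (f u w + g u w - (f0 + g0 + (fu + gu) * u + (fw + gw) * w))
    with ((f u w - (f0 + fu * u + fw * w)) + (g u w - (g0 + gu * u + gw * w))) by ring.
  apply Rle_trans with (1 := Rabs_triang _ _); lra.
Qed.

Lemma expands_mult r f f0 fu fw g g0 gu gw :
  0 <= r -> expands r f f0 fu fw -> expands r g g0 gu gw ->
  expands r (fun u w => f u w * g u w)
    (f0 * g0) (f0 * gu + fu * g0) (f0 * gw + fw * g0).
Proof.
  intros Hr [Kf [HKf Hf]] [Kg [HKg Hg]].
  set (A1 := Rabs fu + Rabs fw); set (B1 := Rabs gu + Rabs gw).
  assert (Hlin : forall a b u w, Rabs (a * u + b * w) <= Rabs a * Rabs u + Rabs b * Rabs w).
  { intros; rewrite <- !Rabs_mult; apply Rabs_triang. }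
  assert (HA1 : 0 <= A1) by (unfold A1; assert (H := Rabs_pos fu); assert (H' := Rabs_pos fw); lra).
  assert (HB1 : 0 <= B1) by (unfold B1; assert (H := Rabs_pos gu); assert (H' := Rabs_pos gw); lra).
  set (A := Rabs f0 + A1 * r); set (B := Rabs g0 + B1 * r).
  assert (HA : 0 <= A).
  { unfold A; assert (H := Rabs_pos f0); assert (H' := Rmult_le_pos _ _ HA1 Hr); lra. }
  assert (HB : 0 <= B).
  { unfold B; assert (H := Rabs_pos g0); assert (H' := Rmult_le_pos _ _ HB1 Hr); lra. }
  (* One summand each for the product of the linear parts, the two products of an affine part
     (bounded by [A] or [B]) with a remainder, and the product of the remainders, where one factor
     [u ^ 2 + w ^ 2] is at most [2 * r ^ 2]. *)
  exists (A1 * B1 + A * Kg + B * Kf + Kf * Kg * (2 * r ^ 2)); split.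
  { assert (0 <= A1 * B1) by now apply Rmult_le_pos.
    assert (0 <= A * Kg) by now apply Rmult_le_pos.
    assert (0 <= B * Kf) by now apply Rmult_le_pos.
    assert (0 <= Kf * Kg) by now apply Rmult_le_pos.
    assert (0 <= Kf * Kg * (2 * r ^ 2))
      by (apply Rmult_le_pos; [assumption|assert (H' := pow2_ge_0 r); lra]).
    lra. }
  intros u w Hu Hw; specialize (Hf u w Hu Hw); specialize (Hg u w Hu Hw).
  set (n := u ^ 2 + w ^ 2) in *.
  set (lf := fu * u + fw * w); set (lg := gu * u + gw * w).
  set (rf := f u w - (f0 + fu * u + fw * w)) in *.
  set (rg := g u w - (g0 + gu * u + gw * w)) in *.
  replace (f u w * g u w - _)
    with (lf * lg + (f0 + lf) * rg + (g0 + lg) * rf + rf * rg)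
    by (unfold lf, lg, rf, rg; ring).
  assert (Hu0 := Rabs_pos u); assert (Hw0 := Rabs_pos w).
  assert (Hu2 : Rabs u * Rabs u = u ^ 2) by (rewrite <- Rabs_mult, Rabs_pos_eq; [ring|nra]).
  assert (Hw2 : Rabs w * Rabs w = w ^ 2) by (rewrite <- Rabs_mult, Rabs_pos_eq; [ring|nra]).
  set (mx := Rmax (Rabs u) (Rabs w)).
  assert (Hmx0 : 0 <= mx) by (apply Rle_trans with (1 := Hu0), Rmax_l).
  assert (Hmxn : mx * mx <= n).
  { unfold n; assert (H1 := pow2_ge_0 u); assert (H2 := pow2_ge_0 w).
    unfold mx, Rmax; destruct Rle_dec; lra. }
  assert (Hmxr : mx <= r) by (now apply Rmax_lub).
  assert (Hlinmx : forall a b, Rabs (a * u + b * w) <= (Rabs a + Rabs b) * mx).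
  { intros a b; apply Rle_trans with (1 := Hlin _ _ _ _); rewrite Rmult_plus_distr_r.
    apply Rplus_le_compat; apply Rmult_le_compat_l; try apply Rabs_pos;
      [apply Rmax_l|apply Rmax_r]. }
  assert (Hn : n <= 2 * r ^ 2).
  { unfold n; assert (Rabs u * Rabs u <= r * r) by now apply Rmult_le_compat.
    assert (Rabs w * Rabs w <= r * r) by now apply Rmult_le_compat. lra. }
  assert (Hn0 : 0 <= n) by (apply Rle_trans with (2 := Hmxn); nra).
  assert (Hlf := Hlinmx fu fw); assert (Hlg := Hlinmx gu gw).
  fold A1 lf in Hlf; fold B1 lg in Hlg.
  assert (H1 : Rabs (lf * lg) <= A1 * B1 * n).
  { rewrite Rabs_mult; apply Rle_trans with (A1 * mx * (B1 * mx)).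
    - apply Rmult_le_compat; auto using Rabs_pos.
    - replace (A1 * mx * (B1 * mx)) with (A1 * B1 * (mx * mx)) by ring.
      apply Rmult_le_compat_l; [now apply Rmult_le_pos|assumption]. }
  assert (H2 : Rabs ((f0 + lf) * rg) <= A * Kg * n).
  { rewrite Rabs_mult, (Rmult_assoc A); apply Rmult_le_compat; auto using Rabs_pos.
    apply Rle_trans with (1 := Rabs_triang _ _); unfold A; apply Rplus_le_compat_l.
    apply Rle_trans with (1 := Hlf); now apply Rmult_le_compat_l. }
  assert (H3 : Rabs ((g0 + lg) * rf) <= B * Kf * n).
  { rewrite Rabs_mult, (Rmult_assoc B); apply Rmult_le_compat; auto using Rabs_pos.
    apply Rle_trans with (1 := Rabs_triang _ _); unfold B; apply Rplus_le_compat_l.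
    apply Rle_trans with (1 := Hlg); now apply Rmult_le_compat_l. }
  assert (H4 : Rabs (rf * rg) <= Kf * Kg * (2 * r ^ 2) * n).
  { rewrite Rabs_mult; apply Rle_trans with (Kf * n * (Kg * n)).
    - apply Rmult_le_compat; auto using Rabs_pos.
    - replace (Kf * n * (Kg * n)) with (Kf * Kg * (n * n)) by ring.
      rewrite (Rmult_assoc (Kf * Kg)); apply Rmult_le_compat_l; [now apply Rmult_le_pos|].
      now apply Rmult_le_compat_r. }
  apply Rle_trans with (1 := Rabs_triang _ _).
  apply Rle_trans with (1 := Rplus_le_compat_r _ _ _ (Rabs_triang _ _)).
  apply Rle_trans with
    (1 := Rplus_le_compat_r _ _ _ (Rplus_le_compat_r _ _ _ (Rabs_triang _ _))).
  lra.
Qed.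

(** * Taylor remainders of sine and cosine *)

Lemma lipschitz_of_derive (f df : R -> R) :
  (forall t, is_derive f t (df t)) -> (forall t, Rabs (df t) <= 1) ->
  forall a b, Rabs (f a - f b) <= Rabs (a - b).
Proof.
  intros Hd Hle a b.
  destruct (MVT_gen f b a df) as [c [_ ->]].
  - intros; apply Hd.
  - intros; apply continuity_pt_filterlim; exact (is_derive_continuous _ _ _ (Hd _)).
  - rewrite Rabs_mult; assert (H := Rabs_pos (a - b)); specialize (Hle c); nra.
Qed.

Lemma cos_lipschitz (a b : R) : Rabs (cos a - cos b) <= Rabs (a - b).
Proof.
  apply (lipschitz_of_derive cos (fun t => - sin t)).
  - intros t; auto_derive; [trivial|ring].
  - intros t; rewrite Rabs_Ropp; apply Rabs_le, SIN_bound.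
Qed.

Lemma sin_lipschitz (a b : R) : Rabs (sin a - sin b) <= Rabs (a - b).
Proof.
  apply (lipschitz_of_derive sin cos).
  - intros t; auto_derive; [trivial|ring].
  - intros t; apply Rabs_le, COS_bound.
Qed.

(** The mean value theorem turns the remainder into [(df c - df x) * u] with [c] within [Rabs u] of
    [x]. *)
Lemma taylor1_of_lipschitz_derive (f df : R -> R) (x u : R) :
  (forall t, is_derive f t (df t)) ->
  (forall a b, Rabs (df a - df b) <= Rabs (a - b)) ->
  Rabs (f (x + u) - f x - df x * u) <= u ^ 2.
Proof.
  intros Hd Hlip.
  destruct (MVT_gen f x (x + u) df) as [c [Hc Heq]].
  - intros; apply Hd.
  - intros; apply continuity_pt_filterlim; exact (is_derive_continuous _ _ _ (Hd _)).
  - rewrite Heq; replace (df c * (x + u - x) - df x * u) with ((df c - df x) * u) by ring.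
    rewrite Rabs_mult.
    assert (Hcu : Rabs (c - x) <= Rabs u).
    { unfold Rmin, Rmax in Hc; destruct (Rle_dec x (x + u)).
      - rewrite !Rabs_pos_eq; lra.
      - rewrite !Rabs_left1; lra. }
    replace (u ^ 2) with (Rabs u * Rabs u)
      by (rewrite <- Rabs_mult, Rabs_pos_eq; [ring|nra]).
    apply Rmult_le_compat_r; [apply Rabs_pos|].
    now apply Rle_trans with (1 := Hlip c x).
Qed.

Lemma expands_sin r x : expands r (fun u _ => sin (x + u)) (sin x) (cos x) 0.
Proof.
  exists 1; split; [lra|]; intros u w _ _.
  replace (sin (x + u) - (sin x + cos x * u + 0 * w))
    with (sin (x + u) - sin x - cos x * u) by ring.
  apply Rle_trans with (u ^ 2); [|assert (H := pow2_ge_0 w); lra].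
  apply taylor1_of_lipschitz_derive with (df := cos).
  - intros t; auto_derive; [trivial|ring].
  - apply cos_lipschitz.
Qed.

Lemma expands_cos r x : expands r (fun u _ => cos (x + u)) (cos x) (- sin x) 0.
Proof.
  exists 1; split; [lra|]; intros u w _ _.
  replace (cos (x + u) - (cos x + - sin x * u + 0 * w))
    with (cos (x + u) - cos x - - sin x * u) by ring.
  apply Rle_trans with (u ^ 2); [|assert (H := pow2_ge_0 w); lra].
  apply taylor1_of_lipschitz_derive with (df := fun t => - sin t).
  - intros t; auto_derive; [trivial|ring].
  - intros a b; replace (- sin a - - sin b) with (- (sin a - sin b)) by ring.
    rewrite Rabs_Ropp; apply sin_lipschitz.
Qed.

(** * The governor near its equilibrium *)

Definition gov_force (rho kappa x z : R) : R :=
  rho * z ^ 2 * cos x + (z ^ 2 + kappa) * sin x * cos x - sin x.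

(* At an equilibrium the linearization has characteristic polynomial
   [l^3 + eps l^2 + gov_a l + gov_c]. *)
Definition gov_a (rho kappa x z : R) : R :=
  rho * z ^ 2 * sin x + (z ^ 2 + kappa) * (sin x ^ 2 - cos x ^ 2) + cos x.

Definition gov_c (alpha rho x z : R) : R :=
  2 * z * cos x * (rho + sin x) * (alpha * sin x).

Lemma gov_force_expands r rho kappa x z :
  0 <= r -> gov_force rho kappa x z = 0 ->
  expands r (fun u w => gov_force rho kappa (x + u) (z + w))
    0 (- gov_a rho kappa x z) (2 * z * cos x * (rho + sin x)).
Proof.
  intros Hr H0.
  assert (Hz := expands_translation_r r z).
  assert (Hz2 := expands_mult _ _ _ _ _ _ _ _ _ Hr Hz Hz).
  assert (Hs := expands_sin r x); assert (Hc := expands_cos r x).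
  assert (H1 := expands_mult _ _ _ _ _ _ _ _ _ Hr
                  (expands_mult _ _ _ _ _ _ _ _ _ Hr (expands_const r rho) Hz2) Hc).
  assert (H2 := expands_mult _ _ _ _ _ _ _ _ _ Hr
                  (expands_mult _ _ _ _ _ _ _ _ _ Hr
                     (expands_plus _ _ _ _ _ _ _ _ _ Hz2 (expands_const r kappa)) Hs) Hc).
  assert (H3 := expands_mult _ _ _ _ _ _ _ _ _ Hr (expands_const r (-1)) Hs).
  destruct (expands_plus _ _ _ _ _ _ _ _ _
              (expands_plus _ _ _ _ _ _ _ _ _ H1 H2) H3) as [K [HK H]].
  exists K; split; [assumption|]; intros u w Hu Hw; specialize (H u w Hu Hw).
  refine (Rle_trans _ _ _ (Req_le _ _ _) H); f_equal.
  unfold gov_force, gov_a in *.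
  (* The coefficients of [u] and [w] agree identically; the constant term vanishes by [H0]. *)
  apply Rminus_diag_uniq; ring_simplify; ring_simplify in H0; lra.
Qed.

(** Adding [eps * (x - x0)] to [y] cancels the friction, so [h'] is the force alone. Then [n2] is
    the Taylor remainder of the force, and [n1] that of [cos] divided by [- sin x0]. *)
Lemma gov_near_jerk alpha beta eps rho kappa x0 z0 :
  0 < alpha -> cos x0 = beta -> 0 < sin x0 ->
  gov_force rho kappa x0 z0 = 0 ->
  exists K, 0 <= K /\ forall (x y z : R -> R) t,
    is_derive x t (gov_f1 (x t) (y t) (z t)) ->
    is_derive y t (gov_f2 eps rho kappa (x t) (y t) (z t)) ->
    is_derive z t (gov_f3 alpha beta (x t) (y t) (z t)) ->
    near_jerk (gov_a rho kappa x0 z0) (gov_c alpha rho x0 z0) eps K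
      (fun t => - (z t - z0) / (alpha * sin x0))
      (fun t => x t - x0)
      (fun t => y t + eps * (x t - x0)) t.
Proof.
  intros Halpha Hbeta Hs H0.
  set (sg := alpha * sin x0).
  assert (Hsg : 0 < sg) by now apply Rmult_lt_0_compat.
  (* [sq3 <= 1] only gives [Rabs u <= 1] and [Rabs w <= sg], since [p = - w / sg]; [r] covers
     both. *)
  set (r := 1 + sg).
  destruct (gov_force_expands r rho kappa x0 z0 ltac:(unfold r; lra) H0) as [K2 [HK2 Hf]].
  destruct (expands_cos r x0) as [K1 [HK1 Hc]].
  set (B := 1 + sg ^ 2).
  assert (HB : 1 <= B) by (unfold B; assert (H := pow2_ge_0 sg); lra).
  assert (Hinv : 0 < / sin x0) by now apply Rinv_0_lt_compat.
  exists (K1 * / sin x0 * B + K2 * B); split.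
  { assert (0 <= K1 * / sin x0) by (apply Rmult_le_pos; lra).
    assert (0 <= K1 * / sin x0 * B) by (apply Rmult_le_pos; lra).
    assert (0 <= K2 * B) by (apply Rmult_le_pos; lra); lra. }
  intros x y z t Hx Hy Hz; unfold gov_f1, gov_f2, gov_f3 in *.
  set (u := x t - x0); set (w := z t - z0).
  exists (- (cos (x t) - beta) / sin x0 - u),
    (gov_force rho kappa (x t) (z t) + gov_c alpha rho x0 z0 * (- w / sg)
     + gov_a rho kappa x0 z0 * u).
  split; [|split; [|split]].
  - auto_derive; [repeat split; eexists; eassumption|].
    rewrite (is_derive_unique (fun s : R => z s) _ _ Hz); unfold u, sg; field; lra.
  - auto_derive; [repeat split; eexists; eassumption|].
    rewrite (is_derive_unique (fun s : R => x s) _ _ Hx); ring.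
  - auto_derive; [repeat split; eexists; eassumption|].
    rewrite (is_derive_unique (fun s : R => x s) _ _ Hx),
      (is_derive_unique (fun s : R => y s) _ _ Hy).
    unfold gov_force, u, w; field; lra.
  - fold u w; intros HS.
    assert (Hn : u ^ 2 + w ^ 2 <= B * sq3 (- w / sg) u (y t + eps * u)).
    { unfold sq3, B.
      replace ((1 + sg ^ 2) * ((- w / sg) ^ 2 + u ^ 2 + (y t + eps * u) ^ 2))
        with (u ^ 2 + w ^ 2
              + ((- w / sg) ^ 2 + sg ^ 2 * u ^ 2 + (1 + sg ^ 2) * (y t + eps * u) ^ 2))
        by (field; lra).
      assert (H1 := pow2_ge_0 (- w / sg)); assert (H2 := pow2_ge_0 sg).
      assert (H3 := pow2_ge_0 u); assert (H4 := pow2_ge_0 (y t + eps * u)).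
      assert (H5 := Rmult_le_pos _ _ H2 H3); nra. }
    unfold sq3 in HS.
    assert (H1 := pow2_ge_0 (- w / sg)); assert (H3 := pow2_ge_0 u).
    assert (H4 := pow2_ge_0 (y t + eps * u)).
    assert (Hu : Rabs u <= r).
    { apply Rle_trans with 1; [|unfold r; lra].
      rewrite <- Rabs_R1; apply Rsqr_le_abs_0; unfold Rsqr; lra. }
    assert (Hw : Rabs w <= r).
    { apply Rle_trans with sg; [|unfold r; lra].
      rewrite <- (Rabs_pos_eq sg) by lra.
      apply Rsqr_le_abs_0; unfold Rsqr.
      replace (w * w) with (sg * sg * (- w / sg) ^ 2) by (field; lra).
      assert (0 < sg * sg) by nra; nra. }
    specialize (Hf u w Hu Hw); specialize (Hc u w Hu Hw).
    replace (x0 + u) with (x t) in * by (unfold u; ring).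
    replace (z0 + w) with (z t) in * by (unfold w; ring).
    set (S := sq3 (- w / sg) u (y t + eps * u)) in *.
    assert (HS0 : 0 <= S) by (unfold S, sq3; lra).
    assert (Hb1 : K1 * (u ^ 2 + w ^ 2) <= K1 * (B * S)) by now apply Rmult_le_compat_l.
    assert (Hb2 : K2 * (u ^ 2 + w ^ 2) <= K2 * (B * S)) by now apply Rmult_le_compat_l.
    assert (HBS : 0 <= B * S) by (apply Rmult_le_pos; lra).
    assert (H2S : 0 <= K2 * (B * S)) by now apply Rmult_le_pos.
    assert (H1S : 0 <= K1 * (B * S)) by now apply Rmult_le_pos.
    split.
    + replace (- (cos (x t) - beta) / sin x0 - u)
        with (- (cos (x t) - (cos x0 + - sin x0 * u + 0 * w)) * / sin x0)
        by (rewrite Hbeta; field; lra).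
      rewrite Rabs_mult, Rabs_Ropp, (Rabs_pos_eq (/ sin x0)) by lra.
      apply Rle_trans with (K1 * (B * S) * / sin x0); [apply Rmult_le_compat_r; lra|lra].
    + refine (Rle_trans _ _ _ (Rle_trans _ _ _ (Req_le _ _ _) Hf) _).
      * f_equal; unfold gov_c; fold sg; field; lra.
      * assert (0 <= K1 * (B * S) * / sin x0) by (apply Rmult_le_pos; lra); lra.
Qed.

(** * Fractional powers and the coefficients at the equilibrium *)

Lemma Rpower_mult_nat (x y : R) (n : nat) : Rpower x (y * INR n) = Rpower x y ^ n.
Proof. rewrite <- Rpower_mult; apply Rpower_pow, exp_pos. Qed.

Lemma Rpower_pow_eq (x y : R) (n : nat) : 0 < x -> y * INR n = 1 -> Rpower x y ^ n = x.
Proof. intros Hx Hy; rewrite <- Rpower_mult_nat, Hy; now apply Rpower_1. Qed.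

Lemma sin_P0x beta : 0 < beta < 1 -> sin (P0x beta) = Rpower (1 - beta ^ 2) (1 / 2).
Proof.
  intros Hb; unfold P0x; rewrite sin_acos by lra.
  rewrite <- Rpower_sqrt by (unfold Rsqr; nra).
  f_equal; [unfold Rsqr; ring|field].
Qed.

(** All fractional powers become natural powers of the four roots [b], [q], [k], [m], which reduces
    the equilibrium equation and the formula for the threshold to rational identities. *)
Lemma P0_linearization alpha beta rho kappa :
  0 < beta < 1 -> 0 < alpha -> 0 <= rho -> 0 <= kappa < 1 ->
  let a := gov_a rho kappa (P0x beta) (P0z beta rho kappa) in
  let c := gov_c alpha rho (P0x beta) (P0z beta rho kappa) in
  0 < sin (P0x beta) /\ gov_force rho kappa (P0x beta) (P0z beta rho kappa) = 0 /\
  0 < a /\ 0 < c /\ c = eps_c alpha beta rho kappa * a.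
Proof.
  intros Hb Halpha Hrho Hkappa; simpl.
  assert (Hsin := sin_P0x beta Hb).
  assert (Hcos : cos (P0x beta) = beta) by (apply cos_acos; lra).
  unfold gov_force, gov_a, gov_c; rewrite Hsin, Hcos; unfold P0z, eps_c; clear Hsin Hcos.
  assert (Hb2 : 0 < 1 - beta ^ 2) by nra.
  assert (Hkb : 0 < 1 - kappa * beta) by nra.
  set (b := Rpower beta (1 / 2)).
  set (q := Rpower (1 - beta ^ 2) (1 / 4)).
  set (k := Rpower (1 - kappa * beta) (1 / 2)).
  assert (Hb0 : 0 < b) by apply exp_pos.
  assert (Hq0 : 0 < q) by apply exp_pos.
  assert (Hk0 : 0 < k) by apply exp_pos.
  assert (Hbeta : b ^ 2 = beta) by (apply Rpower_pow_eq; [lra|simpl; field]).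
  assert (Hk2 : k ^ 2 = 1 - kappa * beta) by (apply Rpower_pow_eq; [lra|simpl; field]).
  assert (Hq4 : q ^ 4 = 1 - beta ^ 2) by (apply Rpower_pow_eq; [lra|simpl; field]).
  assert (Hpow : forall x y z n, z = y * INR n -> Rpower x z = Rpower x y ^ n)
    by (intros x y z n ->; apply Rpower_mult_nat).
  rewrite (Hpow beta (1 / 2) (3 / 2) 3%nat) by (simpl; field).
  rewrite (Hpow (1 - beta ^ 2) (1 / 4) (1 / 2) 2%nat) by (simpl; field).
  rewrite (Hpow (1 - beta ^ 2) (1 / 4) (3 / 4) 3%nat) by (simpl; field).
  rewrite (Hpow (1 - beta ^ 2) (1 / 4) (3 / 2) 6%nat) by (simpl; field).
  fold b q.
  set (m := Rpower (rho + q ^ 2) (1 / 2)).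
  rewrite (Hpow (rho + q ^ 2) (1 / 2) (3 / 2) 3%nat) by (simpl; field).
  fold m.
  assert (Hq2 : 0 < q ^ 2) by now apply pow_lt.
  assert (Hm0 : 0 < m) by apply exp_pos.
  assert (Hm2 : m ^ 2 = rho + q ^ 2) by (apply Rpower_pow_eq; [lra|simpl; field]).
  (* The denominator of [eps_c]; it is also the numerator of [gov_a], hence cancels in the last
     identity. *)
  set (D := q ^ 6 + rho * (1 - kappa * beta ^ 3)).
  assert (HD : 0 < D).
  { assert (0 < q ^ 6) by now apply pow_lt.
    assert (0 <= 1 - kappa * beta ^ 3).
    { assert (beta ^ 3 <= 1) by (rewrite <- (pow1 3); apply pow_incr; lra).
      assert (0 <= beta ^ 3) by (apply pow_le; lra); nra. }
    unfold D; assert (0 <= rho * (1 - kappa * beta ^ 3)) by now apply Rmult_le_pos.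
    lra. }
  assert (Hz2 : (k * q / (b * m)) ^ 2
                = (1 - kappa * beta) * q ^ 2 / (beta * (rho + q ^ 2))).
  { rewrite <- Hm2, <- Hk2, <- Hbeta; field; lra. }
  set (z := k * q / (b * m)) in *.
  assert (Ha : rho * z ^ 2 * q ^ 2 + (z ^ 2 + kappa) * ((q ^ 2) ^ 2 - beta ^ 2) + beta
               = D / (beta * (rho + q ^ 2))).
  { rewrite Hz2; unfold D.
    replace (q ^ 6) with (q ^ 2 * q ^ 4) by ring.
    replace ((q ^ 2) ^ 2) with (q ^ 4) by ring.
    replace (rho * ((1 - kappa * beta) * q ^ 2 / (beta * (rho + q ^ 2))) * q ^ 2)
      with (rho * ((1 - kappa * beta) * q ^ 4 / (beta * (rho + q ^ 2))))
      by (field; lra).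
    rewrite Hq4; field; lra. }
  rewrite Ha.
  assert (Hden : 0 < beta * (rho + q ^ 2)) by (apply Rmult_lt_0_compat; lra).
  split; [assumption|split; [|split; [|split]]].
  - rewrite Hz2; field; lra.
  - now apply Rdiv_lt_0_compat.
  - assert (0 < z) by
      (unfold z; apply Rdiv_lt_0_compat; now apply Rmult_lt_0_compat).
    clearbody z; repeat apply Rmult_lt_0_compat; lra.
  - rewrite <- Hm2; unfold z; rewrite <- Hbeta; field; lra.
Qed.

(** * Stability *)

Lemma dist3_lt_iff a1 a2 a3 b1 b2 b3 d :
  0 < d ->
  dist3 a1 a2 a3 b1 b2 b3 < d <->
  (a1 - b1) ^ 2 + (a2 - b2) ^ 2 + (a3 - b3) ^ 2 < d ^ 2.
Proof.
  intros Hd; unfold dist3.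
  assert (H1 := pow2_ge_0 (a1 - b1)); assert (H2 := pow2_ge_0 (a2 - b2)).
  assert (H3 := pow2_ge_0 (a3 - b3)); split; intros H.
  - replace (d ^ 2) with (d * d) by ring.
    rewrite <- (sqrt_sqrt ((a1 - b1) ^ 2 + _ + _)) by lra.
    assert (H0 := sqrt_pos ((a1 - b1) ^ 2 + (a2 - b2) ^ 2 + (a3 - b3) ^ 2)).
    apply Rmult_le_0_lt_compat; assumption.
  - rewrite <- (sqrt_pow2 d) by lra; apply sqrt_lt_1_alt; lra.
Qed.

(** An invertible linear change of coordinates makes the squared norms comparable; this carries
    estimates on [sq3] over to [dist3]. *)
Lemma jerk_coordinates_equiv sg eps :
  0 < sg -> exists A B, 0 < A /\ 0 < B /\ forall u y w,
    sq3 (- w / sg) u (y + eps * u) <= B * (u ^ 2 + y ^ 2 + w ^ 2) /\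
    u ^ 2 + y ^ 2 + w ^ 2 <= A * sq3 (- w / sg) u (y + eps * u).
Proof.
  intros Hsg; exists (sg ^ 2 + 2 + 2 * eps ^ 2), (/ sg ^ 2 + 2 + 2 * eps ^ 2).
  assert (Hs2 : 0 < sg ^ 2) by now apply pow_lt.
  assert (Hi : 0 < / sg ^ 2) by now apply Rinv_0_lt_compat.
  assert (He := pow2_ge_0 eps).
  split; [lra|split; [lra|]]; intros u y w; unfold sq3.
  assert (Hu := pow2_ge_0 u); assert (Hy := pow2_ge_0 y); assert (Hw := pow2_ge_0 w).
  set (h := y + eps * u); assert (Hh := pow2_ge_0 h).
  replace ((- w / sg) ^ 2) with (/ sg ^ 2 * w ^ 2) by (field; lra).
  split.
  - assert (h ^ 2 <= 2 * y ^ 2 + 2 * eps ^ 2 * u ^ 2).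
    { unfold h; assert (H := pow2_ge_0 (y - eps * u)); nra. }
    assert (0 <= / sg ^ 2 * u ^ 2) by (apply Rmult_le_pos; lra).
    assert (0 <= / sg ^ 2 * y ^ 2) by (apply Rmult_le_pos; lra).
    assert (0 <= eps ^ 2 * y ^ 2) by now apply Rmult_le_pos.
    assert (0 <= eps ^ 2 * w ^ 2) by now apply Rmult_le_pos.
    lra.
  - assert (Hyh : y ^ 2 <= 2 * h ^ 2 + 2 * eps ^ 2 * u ^ 2).
    { replace y with (h - eps * u) by (unfold h; ring).
      assert (H := pow2_ge_0 (h + eps * u)); nra. }
    assert (0 <= / sg ^ 2 * w ^ 2) by (apply Rmult_le_pos; lra).
    assert (Hw' : sg ^ 2 * (/ sg ^ 2 * w ^ 2) = w ^ 2) by (field; lra).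
    assert (0 <= eps ^ 2 * (/ sg ^ 2 * w ^ 2)) by now apply Rmult_le_pos.
    assert (0 <= sg ^ 2 * u ^ 2) by (apply Rmult_le_pos; lra).
    assert (0 <= sg ^ 2 * h ^ 2) by (apply Rmult_le_pos; lra).
    assert (0 <= eps ^ 2 * h ^ 2) by now apply Rmult_le_pos.
    assert (0 <= eps ^ 2 * u ^ 2) by now apply Rmult_le_pos.
    lra.
Qed.

Lemma is_lim_of_sq_exp_decay (f : R -> R) (l M k : R) :
  0 < k -> (forall t, 0 <= t -> (f t - l) ^ 2 <= M * exp (- k * t)) ->
  is_lim f p_infty l.
Proof.
  intros Hk H; apply is_lim_spec; intros e; assert (He := cond_pos e).
  assert (HM : 0 <= M).
  { specialize (H 0 ltac:(lra)); rewrite Rmult_0_r, exp_0 in H.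
    assert (H' := pow2_ge_0 (f 0 - l)); lra. }
  (* Beyond this time [exp (k * t) >= 1 + k * t] exceeds [M / e ^ 2]. *)
  exists (M / (k * e ^ 2)); intros t Ht.
  assert (He2 : 0 < e ^ 2) by now apply pow_lt.
  assert (Hke : 0 < k * e ^ 2) by now apply Rmult_lt_0_compat.
  assert (Ht0 : 0 < t).
  { apply Rle_lt_trans with (2 := Ht); now apply Rdiv_le_0_compat. }
  assert (HMt : M < e ^ 2 * exp (k * t)).
  { apply Rmult_lt_compat_r with (r := k * e ^ 2) in Ht; [|assumption].
    replace (M / (k * e ^ 2) * (k * e ^ 2)) with M in Ht by (field; lra).
    assert (Hexp := exp_ineq1_le (k * t)); nra. }
  assert (Hsq : (f t - l) ^ 2 < e ^ 2).
  { apply Rle_lt_trans with (1 := H t ltac:(lra)).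
    replace (e ^ 2) with (e ^ 2 * exp (k * t) * exp (- k * t)).
    - apply Rmult_lt_compat_r; [apply exp_pos|assumption].
    - rewrite Rmult_assoc, <- exp_plus.
      replace (k * t + - k * t) with 0 by ring; rewrite exp_0; ring. }
  rewrite <- (Rabs_pos_eq e) by lra; apply Rsqr_lt_abs_0; unfold Rsqr; lra.
Qed.

(** One exponential estimate, with constants independent of the time horizon and the solution,
    yields both stability and attraction. *)
Lemma gov_asympt_stable_of_linearization alpha beta eps rho kappa x0 z0 :
  0 < alpha -> cos x0 = beta -> 0 < sin x0 -> gov_force rho kappa x0 z0 = 0 ->
  0 < gov_a rho kappa x0 z0 -> 0 < gov_c alpha rho x0 z0 ->
  gov_c alpha rho x0 z0 < gov_a rho kappa x0 z0 * eps ->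
  gov_asympt_stable alpha beta eps rho kappa x0 0 z0.
Proof.
  intros Halpha Hbeta Hs H0 Ha Hc Hac.
  destruct (gov_near_jerk alpha beta eps rho kappa x0 z0 Halpha Hbeta Hs H0)
    as [K [HK Hjerk]].
  destruct (near_jerk_decay _ _ eps K Ha Hc ltac:(lra) HK)
    as [C [k [r [HC [Hk [Hr Hdecay]]]]]].
  set (sg := alpha * sin x0) in *.
  assert (Hsg : 0 < sg) by now apply Rmult_lt_0_compat.
  destruct (jerk_coordinates_equiv sg eps Hsg) as [A [B [HA [HB Hequiv]]]].
  assert (HrB : 0 < r / B) by now apply Rdiv_lt_0_compat.
  assert (HACB : 0 < A * C * B) by (repeat apply Rmult_lt_0_compat; assumption).
  assert (Hmain : forall T (x y z : R -> R),
    gov_sol_on alpha beta eps rho kappa (fun t => 0 <= t <= T) x y z ->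
    (x 0 - x0) ^ 2 + (y 0 - 0) ^ 2 + (z 0 - z0) ^ 2 < r / B ->
    forall t, 0 <= t <= T ->
      (x t - x0) ^ 2 + (y t - 0) ^ 2 + (z t - z0) ^ 2
      <= A * C * B * ((x 0 - x0) ^ 2 + (y 0 - 0) ^ 2 + (z 0 - z0) ^ 2) * exp (- k * t)).
  { intros T x y z Hsol Hini t Ht; rewrite !Rminus_0_r in *.
    destruct (Hequiv (x t - x0) (y t) (z t - z0)) as [_ Hup].
    destruct (Hequiv (x 0 - x0) (y 0) (z 0 - z0)) as [Hlow _].
    apply Rle_trans with (1 := Hup).
    rewrite !(Rmult_assoc A); apply Rmult_le_compat_l; [lra|].
    refine (Rle_trans _ _ _ (Hdecay T (fun t => - (z t - z0) / sg) (fun t => x t - x0)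
              (fun t => y t + eps * (x t - x0)) ltac:(lra) _ _ t Ht) _).
    - intros s Hs'; destruct (Hsol s Hs') as [Hx [Hy Hz]]; now apply Hjerk.
    - apply Rle_lt_trans with (1 := Hlow).
      apply Rmult_lt_compat_l with (r := B) in Hini; [|assumption].
      replace (B * (r / B)) with r in Hini by (field; lra); assumption.
    - rewrite !Rmult_assoc; apply Rmult_le_compat_l; [lra|].
      rewrite <- !Rmult_assoc; apply Rmult_le_compat_r; [apply Rlt_le, exp_pos|].
      exact Hlow. }
  split.
  - intros e He.
    (* The first entry puts the start where the decay estimate applies, the second keeps its
       right-hand side below [e ^ 2]. *)
    set (X := Rmin (r / B) (e ^ 2 / (A * C * B))).
    assert (HX : 0 < X).
    { apply Rmin_glb_lt; [assumption|apply Rdiv_lt_0_compat; [now apply pow_lt|assumption]]. }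
    exists (sqrt X); split; [now apply sqrt_lt_R0|].
    intros T x y z Hsol Hini t Ht.
    apply dist3_lt_iff in Hini; [|now apply sqrt_lt_R0].
    rewrite pow2_sqrt in Hini by lra.
    apply dist3_lt_iff; [assumption|].
    apply Rle_lt_trans with (1 := Hmain T x y z Hsol
      ltac:(apply Rlt_le_trans with (1 := Hini), Rmin_l) t Ht).
    set (S0 := (x 0 - x0) ^ 2 + (y 0 - 0) ^ 2 + (z 0 - z0) ^ 2) in *.
    assert (HS0 : 0 <= S0).
    { unfold S0; assert (H1 := pow2_ge_0 (x 0 - x0)); assert (H2 := pow2_ge_0 (y 0 - 0)).
      assert (H3 := pow2_ge_0 (z 0 - z0)); lra. }
    assert (Hexp : exp (- k * t) <= 1) by (rewrite <- exp_0; apply exp_le_compat; nra).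
    apply Rle_lt_trans with (A * C * B * S0).
    { rewrite <- (Rmult_1_r (A * C * B * S0)) at 2.
      apply Rmult_le_compat_l; [apply Rmult_le_pos; lra|assumption]. }
    replace (e ^ 2) with (A * C * B * (e ^ 2 / (A * C * B))) by (field; lra).
    apply Rmult_lt_compat_l; [assumption|].
    apply Rlt_le_trans with (1 := Hini), Rmin_r.
  - exists (sqrt (r / B)); split; [now apply sqrt_lt_R0|].
    intros x y z Hsol Hini.
    apply dist3_lt_iff in Hini; [|now apply sqrt_lt_R0].
    rewrite pow2_sqrt in Hini by lra.
    assert (Hall : forall t, 0 <= t ->
      (x t - x0) ^ 2 + (y t - 0) ^ 2 + (z t - z0) ^ 2
      <= A * C * B * ((x 0 - x0) ^ 2 + (y 0 - 0) ^ 2 + (z 0 - z0) ^ 2) * exp (- k * t)).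
    { intros t Ht; apply Hmain with t; [|assumption|lra].
      intros s Hs'; apply Hsol; lra. }
    repeat split; eapply is_lim_of_sq_exp_decay with (1 := Hk); intros t Ht;
      refine (Rle_trans _ _ _ _ (Hall t Ht));
      assert (H1 := pow2_ge_0 (x t - x0)); assert (H2 := pow2_ge_0 (y t - 0));
      assert (H3 := pow2_ge_0 (z t - z0)); lra.
Qed.

(** * Instability *)

(** Projection onto [[z0 - 1, z0 + 1]]. The factor [z ^ 2] is the only obstruction to a global
    Lipschitz bound. *)
Definition clamp (z0 z : R) : R := z0 + Rmax (-1) (Rmin 1 (z - z0)).

Lemma clamp_id z0 z : (z - z0) ^ 2 <= 1 -> clamp z0 z = z.
Proof.
  intros H; unfold clamp, Rmax, Rmin; repeat destruct Rle_dec; nra.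
Qed.

Lemma clamp_bound z0 z : Rabs (clamp z0 z) <= Rabs z0 + 1.
Proof.
  apply Rle_trans with (1 := Rabs_triang _ _), Rplus_le_compat_l, Rabs_le.
  unfold Rmax, Rmin; repeat destruct Rle_dec; lra.
Qed.

Lemma clamp_lipschitz z0 a b : Rabs (clamp z0 a - clamp z0 b) <= Rabs (a - b).
Proof.
  unfold clamp, Rmax, Rmin, Rabs;
    repeat destruct Rle_dec; repeat destruct Rcase_abs; lra.
Qed.

Lemma lipschitz_mult f f' g g' A B Mf Mg d :
  Rabs (f - f') <= A * d -> Rabs (g - g') <= B * d ->
  Rabs f <= Mf -> Rabs g' <= Mg ->
  Rabs (f * g - f' * g') <= (Mf * B + Mg * A) * d.
Proof.
  intros Hf Hg HMf HMg.
  replace (f * g - f' * g') with (f * (g - g') + g' * (f - f')) by ring.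
  apply Rle_trans with (1 := Rabs_triang _ _); rewrite !Rabs_mult.
  apply Rle_trans with (Mf * (B * d) + Mg * (A * d)); [|lra].
  apply Rplus_le_compat; apply Rmult_le_compat; auto using Rabs_pos.
Qed.

Inductive coord : Set := cx | cy | cz.

(** With three coordinates, the neighbourhoods coming from each of them can be intersected. *)
Lemma sup_lipschitz_preserves_continuity L (F : coord -> (coord -> R) -> R) :
  0 < L -> sup_lipschitz L F -> preserves_continuity F.
Proof.
  intros HL HF X HX i t.
  apply filterlim_locally; intros e; assert (He := cond_pos e).
  assert (He' : 0 < e / (2 * L)) by (apply Rdiv_lt_0_compat; lra).
  assert (Hball := fun j => proj1 (filterlim_locally _ _) (HX j t) (mkposreal _ He')).
  generalize (filter_and _ _ (Hball cx) (filter_and _ _ (Hball cy) (Hball cz))).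
  apply filter_imp; intros s [Hx [Hy Hz]].
  change (Rabs (F i (fun j => X j s) - F i (fun j => X j t)) < e).
  apply Rle_lt_trans with (L * (e / (2 * L))).
  - apply HF; intros []; apply Rlt_le; assumption.
  - replace (L * (e / (2 * L))) with (e / 2) by (field; lra); lra.
Qed.

Definition clamped_field (alpha beta eps rho kappa z0 : R) (i : coord) (u : coord -> R)
    : R :=
  match i with
  | cx => gov_f1 (u cx) (u cy) (u cz)
  | cy => gov_f2 eps rho kappa (u cx) (u cy) (clamp z0 (u cz))
  | cz => gov_f3 alpha beta (u cx) (u cy) (u cz)
  end.

Lemma clamped_field_lipschitz alpha beta eps rho kappa z0 :
  exists L, 0 < L /\ sup_lipschitz L (clamped_field alpha beta eps rho kappa z0).
Proof.
  set (B := Rabs z0 + 1).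
  assert (HB : 0 < B) by (unfold B; assert (H := Rabs_pos z0); lra).
  (* [L1] and [L2] keep the shape produced by repeated use of [lipschitz_mult] on the two products
     in the second equation. *)
  set (L1 := Rabs rho * (B * B * 1 + 1 * (B * 1 + B * 1))).
  set (L2 := (B * B + Rabs kappa) * 1 * 1 + 1 * ((B * B + Rabs kappa) * 1 + 1 * (B * 1 + B * 1))).
  set (L := 1 + (L1 + L2 + 1 + Rabs eps) + Rabs alpha).
  assert (Hr := Rabs_pos rho); assert (Hk := Rabs_pos kappa).
  assert (He := Rabs_pos eps); assert (Ha := Rabs_pos alpha).
  assert (HBB : 0 < B * B) by now apply Rmult_lt_0_compat.
  assert (HL1 : 0 <= L1) by (unfold L1; apply Rmult_le_pos; lra).
  assert (HL2 : 0 <= L2) by (unfold L2; lra).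
  exists L; split; [unfold L; lra|].
  intros i u v d Huv.
  assert (Hd : 0 <= d) by (apply Rle_trans with (2 := Huv cx), Rabs_pos).
  assert (Hle : forall l, 0 <= l <= L -> l * d <= L * d)
    by (intros l Hl; apply Rmult_le_compat_r; lra).
  assert (Hcos := Rle_trans _ _ _ (cos_lipschitz (u cx) (v cx)) (Huv cx)).
  assert (Hsin := Rle_trans _ _ _ (sin_lipschitz (u cx) (v cx)) (Huv cx)).
  rewrite <- (Rmult_1_l d) in Hcos, Hsin.
  destruct i; unfold clamped_field, gov_f1, gov_f2, gov_f3.
  - apply Rle_trans with (1 := Huv cy); rewrite <- (Rmult_1_l d) at 1.
    apply Hle; unfold L; lra.
  - assert (Hz := Rle_trans _ _ _ (clamp_lipschitz z0 (u cz) (v cz)) (Huv cz)).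
    rewrite <- (Rmult_1_l d) in Hz.
    set (Z := clamp z0 (u cz)) in *; set (Z' := clamp z0 (v cz)) in *.
    assert (HZ : Rabs Z <= B) by apply clamp_bound.
    assert (HZ' : Rabs Z' <= B) by apply clamp_bound.
    assert (Hsb : forall x, Rabs (sin x) <= 1) by (intros; apply Rabs_le, SIN_bound).
    assert (Hcb : forall x, Rabs (cos x) <= 1) by (intros; apply Rabs_le, COS_bound).
    assert (HZ2 : Rabs (Z * Z) <= B * B)
      by (rewrite Rabs_mult; apply Rmult_le_compat; auto using Rabs_pos).
    assert (Hz2 := lipschitz_mult _ _ _ _ _ _ _ _ _ Hz Hz HZ HZ').
    assert (H1 := lipschitz_mult _ _ _ _ _ _ _ _ _ Hz2 Hcos HZ2 (Hcb (v cx))).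
    assert (Hzk : Rabs ((Z * Z + kappa) - (Z' * Z' + kappa)) <= (B * 1 + B * 1) * d).
    { replace (Z * Z + kappa - (Z' * Z' + kappa)) with (Z * Z - Z' * Z') by ring.
      assumption. }
    assert (HZk : Rabs (Z * Z + kappa) <= B * B + Rabs kappa).
    { apply Rle_trans with (1 := Rabs_triang _ _); lra. }
    assert (H2 := lipschitz_mult _ _ _ _ _ _ _ _ _ Hzk Hsin HZk (Hsb (v cx))).
    assert (HZks : Rabs ((Z * Z + kappa) * sin (u cx)) <= (B * B + Rabs kappa) * 1).
    { rewrite Rabs_mult; apply Rmult_le_compat; auto using Rabs_pos. }
    assert (H3 := lipschitz_mult _ _ _ _ _ _ _ _ _ H2 Hcos HZks (Hcb (v cx))).
    replace (rho * Z ^ 2 * cos (u cx) + (Z ^ 2 + kappa) * sin (u cx) * cos (u cx)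
             - sin (u cx) - eps * u cy
             - (rho * Z' ^ 2 * cos (v cx) + (Z' ^ 2 + kappa) * sin (v cx) * cos (v cx)
                - sin (v cx) - eps * v cy))
      with (rho * (Z * Z * cos (u cx) - Z' * Z' * cos (v cx))
            + ((Z * Z + kappa) * sin (u cx) * cos (u cx)
               - (Z' * Z' + kappa) * sin (v cx) * cos (v cx))
            + - (sin (u cx) - sin (v cx)) + - (eps * (u cy - v cy))) by ring.
    apply Rle_trans with (1 := Rabs_triang _ _).
    apply Rle_trans with (1 := Rplus_le_compat_r _ _ _ (Rabs_triang _ _)).
    apply Rle_trans with
      (1 := Rplus_le_compat_r _ _ _ (Rplus_le_compat_r _ _ _ (Rabs_triang _ _))).
    rewrite !Rabs_Ropp, (Rabs_mult rho), (Rabs_mult eps).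
    assert (H1' := Rmult_le_compat_l _ _ _ Hr H1).
    assert (H4 := Rmult_le_compat_l _ _ _ He (Huv cy)).
    apply Rle_trans with ((L1 + L2 + 1 + Rabs eps) * d);
      [unfold L1, L2; lra|apply Hle; unfold L; lra].
  - replace (alpha * (cos (u cx) - beta) - alpha * (cos (v cx) - beta))
      with (alpha * (cos (u cx) - cos (v cx))) by ring.
    rewrite Rabs_mult.
    apply Rle_trans with (Rabs alpha * d); [apply Rmult_le_compat_l; lra|].
    apply Hle; unfold L; lra.
Qed.

Lemma clamped_solution alpha beta eps rho kappa z0 p1 p2 p3 :
  exists x y z : R -> R, x 0 = p1 /\ y 0 = p2 /\ z 0 = p3 /\ forall t,
    is_derive x t (gov_f1 (x t) (y t) (z t)) /\
    is_derive y t (gov_f2 eps rho kappa (x t) (y t) (clamp z0 (z t))) /\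
    is_derive z t (gov_f3 alpha beta (x t) (y t) (z t)).
Proof.
  set (F := clamped_field alpha beta eps rho kappa z0).
  set (p := fun i => match i with cx => p1 | cy => p2 | cz => p3 end).
  destruct (clamped_field_lipschitz alpha beta eps rho kappa z0) as [L [HL HF]].
  destruct (lipschitz_global_solution F p L
              (Rabs (F cx p) + Rabs (F cy p) + Rabs (F cz p)) HL
              (sup_lipschitz_preserves_continuity L F HL HF) HF) as [X [HX0 HX]].
  - assert (H1 := Rabs_pos (F cx p)); assert (H2 := Rabs_pos (F cy p)).
    assert (H3 := Rabs_pos (F cz p)); intros []; lra.
  - exists (X cx), (X cy), (X cz).
    split; [apply HX0|split; [apply HX0|split; [apply HX0|]]].
    intros t; exact (conj (HX cx t) (conj (HX cy t) (HX cz t))).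
Qed.

(** Stability would confine a clamped solution to a ball where the clamp is the identity. It would
    then solve the governor system for all positive time, against the bound that growth puts on the
    time spent in that ball. *)
Lemma gov_unstable_of_linearization alpha beta eps rho kappa x0 z0 :
  0 < alpha -> 0 < eps -> cos x0 = beta -> 0 < sin x0 ->
  gov_force rho kappa x0 z0 = 0 ->
  0 < gov_a rho kappa x0 z0 -> 0 < gov_c alpha rho x0 z0 ->
  gov_a rho kappa x0 z0 * eps < gov_c alpha rho x0 z0 ->
  gov_unstable alpha beta eps rho kappa x0 0 z0.
Proof.
  intros Halpha Heps Hbeta Hs H0 Ha Hc Hac Hstable.
  destruct (gov_near_jerk alpha beta eps rho kappa x0 z0 Halpha Hbeta Hs H0)
    as [K [HK Hjerk]].
  destruct (near_jerk_growth _ _ eps K Ha Hc ltac:(lra) HK)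
    as [C [k [r [HC [Hk [Hr Hgrowth]]]]]].
  set (sg := alpha * sin x0) in *.
  assert (Hsg : 0 < sg) by now apply Rmult_lt_0_compat.
  destruct (jerk_coordinates_equiv sg eps Hsg) as [A [B [_ [HB Hequiv]]]].
  (* The squared radius: [1] makes the clamp inactive, [r / B] keeps [sq3] within the range of the
     growth estimate. *)
  set (X := Rmin 1 (r / B)).
  assert (HX : 0 < X) by (apply Rmin_glb_lt; [lra|now apply Rdiv_lt_0_compat]).
  assert (HX1 : X <= 1) by apply Rmin_l.
  assert (HXr : B * X <= r).
  { replace r with (B * (r / B)) by (field; lra).
    apply Rmult_le_compat_l; [lra|apply Rmin_r]. }
  set (e := sqrt X).
  assert (He : 0 < e) by now apply sqrt_lt_R0.
  assert (He2 : e ^ 2 = X) by (apply pow2_sqrt; lra).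
  destruct (Hstable e He) as [d [Hd Hst]].
  set (m := Rmin d e).
  assert (Hm : 0 < m) by now apply Rmin_glb_lt.
  assert (Hmd : m <= d) by apply Rmin_l.
  assert (Hme : m <= e) by apply Rmin_r.
  (* The start [(x0 + q0, - eps * q0, z0)] has [p = h = 0] and lies within [q0 * (1 + eps) = m / 2]
     of the equilibrium. *)
  set (q0 := m / (2 * (1 + eps))).
  assert (Hq0 : 0 < q0) by (apply Rdiv_lt_0_compat; lra).
  assert (Hq0m : q0 * (1 + eps) = m / 2) by (unfold q0; field; lra).
  destruct (clamped_solution alpha beta eps rho kappa z0 (x0 + q0) (- eps * q0) z0)
    as [x [y [z [Hx0 [Hy0 [Hz0 Hsol]]]]]].
  set (phi := fun t => (x t - x0) ^ 2 + (y t - 0) ^ 2 + (z t - z0) ^ 2).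
  assert (Hphi0 : phi 0 < m ^ 2).
  { unfold phi; rewrite Hx0, Hy0, Hz0.
    replace ((x0 + q0 - x0) ^ 2 + (- eps * q0 - 0) ^ 2 + (z0 - z0) ^ 2)
      with ((q0 * (1 + eps)) ^ 2 - 2 * eps * q0 ^ 2) by ring.
    rewrite Hq0m; assert (0 < q0 ^ 2) by now apply pow_lt.
    assert (0 < m ^ 2) by now apply pow_lt. nra. }
  assert (Hgov : forall t, phi t <= e ^ 2 ->
    is_derive x t (gov_f1 (x t) (y t) (z t)) /\
    is_derive y t (gov_f2 eps rho kappa (x t) (y t) (z t)) /\
    is_derive z t (gov_f3 alpha beta (x t) (y t) (z t))).
  { intros t Ht; rewrite <- (clamp_id z0 (z t)) at 2; [apply Hsol|].
    unfold phi in Ht; assert (H1 := pow2_ge_0 (x t - x0)).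
    assert (H2 := pow2_ge_0 (y t - 0)); lra. }
  (* Up to the first time at which [phi] reaches [e ^ 2] the clamped solution is a true one, so
     stability applies on that interval and contradicts the equality at its end. *)
  assert (Hsmall : forall t, 0 <= t -> phi t < e ^ 2).
  { intros t Ht; destruct (Rlt_or_le (phi t) (e ^ 2)) as [|Hge]; [assumption|exfalso].
    destruct (first_hitting_time phi t (e ^ 2)) as [t1 [Ht1 [Heq Hlt]]]; try assumption.
    - intros s _; destruct (Hsol s) as [Hx [Hy Hz]].
      apply (ex_derive_continuous phi); unfold phi; auto_derive.
      repeat split; eexists; eassumption.
    - apply Rlt_le_trans with (1 := Hphi0), pow_incr; lra.
    - assert (Hdist : dist3 (x t1) (y t1) (z t1) x0 0 z0 < e).
      { apply Hst with t1; [| |lra].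
        - intros s Hs'; apply Hgov.
          destruct (Rle_lt_or_eq_dec s t1 (proj2 Hs')) as [Hlt'| ->]; [|lra].
          apply Rlt_le, Hlt; lra.
        - apply dist3_lt_iff; [assumption|].
          apply Rlt_le_trans with (1 := Hphi0), pow_incr; lra. }
      apply dist3_lt_iff in Hdist; [|assumption].
      unfold phi in Heq; lra. }
  (* Chosen so that [q0 ^ 2 * exp (k * T) >= q0 ^ 2 * (1 + k * T) = q0 ^ 2 + C > C]. *)
  set (T := C / (k * q0 ^ 2)).
  assert (Hq2 : 0 < q0 ^ 2) by now apply pow_lt.
  assert (Hkq : 0 < k * q0 ^ 2) by now apply Rmult_lt_0_compat.
  assert (HT : 0 < T) by now apply Rdiv_lt_0_compat.
  assert (Hbound : q0 ^ 2 * exp (k * T) <= C).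
  { replace q0 with (x 0 - x0) by (rewrite Hx0; ring).
    apply (Hgrowth T (fun t => - (z t - z0) / sg) (fun t => x t - x0)
             (fun t => y t + eps * (x t - x0))); [lra| | | |].
    - intros t Ht; destruct (Hgov t) as [Hx [Hy Hz]].
      + apply Rlt_le, Hsmall; lra.
      + now apply Hjerk.
    - intros t Ht; destruct (Hequiv (x t - x0) (y t) (z t - z0)) as [Hle _].
      apply Rle_trans with (1 := Hle), Rle_trans with (2 := HXr).
      apply Rmult_le_compat_l; [lra|].
      specialize (Hsmall t ltac:(lra)); unfold phi in Hsmall.
      rewrite Rminus_0_r in Hsmall; lra.
    - rewrite Hz0; field; lra.
    - rewrite Hx0, Hy0; ring. }
  assert (Hexp := exp_ineq1_le (k * T)).
  assert (HkT : q0 ^ 2 * (k * T) = C) by (unfold T; field; lra).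
  nra.
Qed.

Theorem theorem2p2 (alpha beta eps rho kappa : R) :
  0 < beta < 1 -> 0 < alpha -> 0 < eps -> 0 <= rho -> 0 <= kappa < 1 ->
  (eps_c alpha beta rho kappa < eps ->
     gov_asympt_stable alpha beta eps rho kappa
       (P0x beta) P0y (P0z beta rho kappa)) /\
  (eps < eps_c alpha beta rho kappa ->
     gov_unstable alpha beta eps rho kappa
       (P0x beta) P0y (P0z beta rho kappa)).
Proof.
  intros Hb Halpha Heps Hrho Hkappa.
  destruct (P0_linearization alpha beta rho kappa Hb Halpha Hrho Hkappa)
    as [Hs [H0 [Ha [Hc Hec]]]].
  assert (Hcos : cos (P0x beta) = beta) by (apply cos_acos; lra).
  (* Multiplication by [gov_a > 0] turns the comparison with [eps_c] into the Routh-Hurwitz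
     comparison of [gov_c] with [gov_a * eps]. *)
  split; intros Hlt; apply Rmult_lt_compat_r with (1 := Ha) in Hlt; rewrite <- Hec in Hlt.
  - apply gov_asympt_stable_of_linearization; try assumption; lra.
  - apply gov_unstable_of_linearization; try assumption; lra.
Qed.
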